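(* For every positive integer $s$ and all positive integers $c_1,\dots,c_{2s}$, \[ \zeta(\{1\}^{c_1-1},c_2+1,\dots,\{1\}^{c_{2s-1}-1},c_{2s}+1)=Z(\mathfrak{D}(c_1,\dots,c_{2s})). \]
   Context: An index is a finite (possibly empty) tuple of positive integers; it is admissible if nonempty with last entry $\ge2$; the multiple zeta value of an admissible index $(k_1,\dots,k_r)$ is $\zeta(k_1,\dots,k_r)=\sum_{0<n_1<\cdots<n_r}n_1^{-k_1}\cdots n_r^{-k_r}$. $\{1\}^m$ denotes $m$ consecutive entries equal to $1$. Let $\mathcal{H}=\mathbb{Q}\langle x,y\rangle$ (noncommutative polynomials), $\mathcal{H}^0=\mathbb{Q}+y\mathcal{H}x$, $\mathcal{H}^{\ge2}=\mathbb{Q}+yx\,\mathbb{Q}\langle x,yx\rangle$, $e_k=yx^{k-1}$. Every word in $y\mathcal{H}x$ is uniquely $e_{k_1}\cdots e_{k_r}$ with $(k_1,\dots,k_r)$ admissible; $Z\colon\mathcal{H}^0\to\mathbb{R}$ is the $\mathbb{Q}$-linear map with $Z(1)=1$, $Z(e_{k_1}\cdots e_{k_r})=\zeta(k_1,\dots,k_r)$. Notation: $[n]=\{1,\dots,n\}$. For an index $\boldsymbol{c}=(c_1,\dots,c_r)$: $[r]^1_{\boldsymbol{c}}=\{i\in[r]:c_i=1\}$, $[r]^{>1}_{\boldsymbol{c}}=\{i\in[r]:c_i>1\}$; for $A\subset[r]$ with $[r]\setminus A=\{i_1<\dots<i_t\}$, $\boldsymbol{c}_{(-A)}=(c_{i_1},\dots,c_{i_t})$,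 and for $B\subset[r]$, $\boldsymbol{c}_{(-A)}-\boldsymbol{\delta}_B=(c_{i_1}-\delta_{i_1\in B},\dots,c_{i_t}-\delta_{i_t\in B})$ where $\delta_{i\in B}$ is $1$ if $i\in B$ and $0$ otherwise. A subset $A\subset[2s]$ is even-odd if (for even $i$, $i\in A\Rightarrow i+1\in A$) and (for odd $i$, $i\in A\Rightarrow i-1\in A$); it is odd-even if (for odd $i$, $i\in A\Rightarrow i+1\in A$) and (for even $i$, $i\in A\Rightarrow i-1\in A$). The $\mathbb{Q}$-linear map $\mathcal{D}\colon\mathcal{H}^0\to\mathcal{H}^{\ge2}$ is defined by $\mathcal{D}(1)=1$ and, writing $\mathfrak{D}(\boldsymbol{c})=\mathcal{D}(y^{c_1}x^{c_2}\cdots y^{c_{2s-1}}x^{c_{2s}})$ for an index $\boldsymbol{c}=(c_1,\dots,c_{2s})$ of even depth (with $\mathfrak{D}(\varnothing)=1$), by the recursion \begin{align*} \mathfrak{D}(\boldsymbol{c})&=\sum_{\substack{A\subset[2s]^1_{\boldsymbol{c}}\\ A\text{ even-odd}}}\ \sum_{\substack{B\subset[2s]^{>1}_{\boldsymbol{c}},\ \#A+\#B\ge1\\ \{2r,2r+1\}\not\subset B\ (r\in[s-1])}}(-1)^{\#B-1}\mathfrak{D}(\boldsymbol{c}_{(-A)}-\boldsymbol{\delta}_B)\,x^{\#A+\#B}\\ &\quad+\sum_{\substack{A\subset[2s]^1_{\boldsymbol{c}}\\ A\text{ even-odd}}}\ \sum_{\substack{B\subset[2s]^{>1}_{\boldsymbol{c}},\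 \#A+\#B\ge2\\ \{2r,2r+1\}\not\subset B\ (r\in[s-1])}}(-1)^{\#B-1}\mathfrak{D}(\boldsymbol{c}_{(-A)}-\boldsymbol{\delta}_B)\,yx^{\#A+\#B-1}\\ &\quad+\sum_{\substack{A\subset[2s]^1_{\boldsymbol{c}}\\ A\text{ odd-even}}}\ \sum_{\substack{B\subset[2s]^{>1}_{\boldsymbol{c}},\ \#A+\#B\ge2\\ \{2r-1,2r\}\not\subset B\ (r\in[s])}}(-1)^{\#B}\mathfrak{D}(\boldsymbol{c}_{(-A)}-\boldsymbol{\delta}_B)\,yx^{\#A+\#B-1}. \end{align*} (Each $\boldsymbol{c}_{(-A)}-\boldsymbol{\delta}_B$ on the right is an even-depth index of strictly smaller weight, so this determines $\mathcal{D}$.) *)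

(* Defs.v *)
From HB Require Import structures.
From mathcomp Require Import all_boot all_order all_algebra.
From mathcomp Require Import all_classical all_reals all_analysis.
Set Implicit Arguments. Unset Strict Implicit. Unset Printing Implicit Defensive.
Import Order.TTheory GRing.Theory Num.Theory.
Import numFieldNormedType.Exports.

Local Open Scope ring_scope.

(* hpart [:: k_r; ...; k_1] m = sum over 0 < n_1 < ... < n_r < m of prod n_i^{-k_i} *)
Fixpoint hpart (R : realType) (rk : seq nat) (m : nat) : R :=
  match rk with
  | [::] => 1
  | k :: rest => \sum_(1 <= n < m) (n%:R ^- k) * hpart R rest n
  end.

Definition mzv_partial (R : realType) (ks : seq nat) (N : nat) : R :=
  hpart R (rev ks) N.+1.

Definition mzv (R : realType) (ks : seq nat) : R :=
  limn (fun N => mzv_partial R ks N).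

(* letters: true = y, false = x; words = seq bool;
   elements of H = formal Q-linear combinations of words *)
Definition ncpoly := seq (rat * seq bool).

(* decomposition of a word y x^{k_1-1} ... y x^{k_r-1} into (k_1,...,k_r) *)
Definition word_index (w : seq bool) : seq nat :=
  (foldr (fun b st => if b then (0%N, (st.1).+1 :: st.2)
                      else ((st.1).+1, st.2)) (0%N, [::]) w).2.

(* Z on words: Z(1) = 1, Z(e_{k_1}...e_{k_r}) = zeta(k_1,...,k_r) for words in yHx.
   Words outside H^0 are given the (unused) value 0. *)
Definition Zword (R : realType) (w : seq bool) : R :=
  if w is [::] then 1
  else if (head false w == true) && (last true w == false)
       then mzv R (word_index w) else 0.

Definition Zlin (R : realType) (p : ncpoly) : R :=
  \sum_(t <- p) ratr t.1 * Zword R t.2.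

Definition scale_nc (a : rat) (p : ncpoly) : ncpoly := [seq (a * t.1, t.2) | t <- p].
Definition rmul_word (p : ncpoly) (w : seq bool) : ncpoly := [seq (t.1, t.2 ++ w) | t <- p].
Definition x_pow (m : nat) : seq bool := nseq m false.
Definition yx_pow (m : nat) : seq bool := true :: nseq m false.

(* ---------- Subsets of [n] as bit masks (position i <-> entry i-1) ---------- *)
Fixpoint allmasks (n : nat) : seq (seq bool) :=
  match n with
  | 0 => [:: [::]]
  | n'.+1 => [seq b :: m | b <- [:: false; true], m <- allmasks n']
  end.

Definition inA (A : seq bool) (i : nat) : bool := (0 < i)%N && nth false A i.-1.
Definition card_mask (A : seq bool) : nat := count id A.

Definition sub_ones (c : seq nat) (A : seq bool) : bool :=
  all (fun i => inA A i ==> (nth 0%N c i.-1 == 1%N)) (iota 1 (size c)).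
Definition sub_gt1 (c : seq nat) (B : seq bool) : bool :=
  all (fun i => inA B i ==> (1 < nth 0%N c i.-1)%N) (iota 1 (size c)).

Definition even_odd (n : nat) (A : seq bool) : bool :=
  all (fun i => ((~~ odd i) && inA A i ==> inA A i.+1) &&
                (odd i && inA A i ==> inA A i.-1)) (iota 1 n).
Definition odd_even (n : nat) (A : seq bool) : bool :=
  all (fun i => (odd i && inA A i ==> inA A i.+1) &&
                ((~~ odd i) && inA A i ==> inA A i.-1)) (iota 1 n).

Definition noEO (s : nat) (B : seq bool) : bool :=
  all (fun r => ~~ (inA B (2 * r) && inA B (2 * r).+1)) (iota 1 s.-1).
Definition noOE (s : nat) (B : seq bool) : bool :=
  all (fun r => ~~ (inA B (2 * r).-1 && inA B (2 * r))) (iota 1 s).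

Definition reduce (c : seq nat) (A B : seq bool) : seq nat :=
  [seq (nth 0%N c i.-1 - inA B i)%N | i <- iota 1 (size c) & ~~ inA A i].

Definition mask_pairs (n : nat) : seq (seq bool * seq bool) :=
  [seq (A, B) | A <- allmasks n, B <- allmasks n].

(* (-1)^{#B-1} is written (-1)^{#B+1}. *)
Fixpoint Dfuel (fuel : nat) (c : seq nat) : ncpoly :=
  match fuel with
  | 0 => [:: (1, [::])]
  | fuel'.+1 =>
    if c is [::] then [:: (1, [::])] else
    let n := size c in
    let s := n./2 in
    let t1 := flatten
      [seq rmul_word (scale_nc ((-1) ^+ (card_mask AB.2).+1)
                               (Dfuel fuel' (reduce c AB.1 AB.2)))
                     (x_pow (card_mask AB.1 + card_mask AB.2))
      | AB <- mask_pairs n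
      & [&& sub_ones c AB.1, even_odd n AB.1, sub_gt1 c AB.2,
            (1 <= card_mask AB.1 + card_mask AB.2)%N & noEO s AB.2]] in
    let t2 := flatten
      [seq rmul_word (scale_nc ((-1) ^+ (card_mask AB.2).+1)
                               (Dfuel fuel' (reduce c AB.1 AB.2)))
                     (yx_pow (card_mask AB.1 + card_mask AB.2).-1)
      | AB <- mask_pairs n
      & [&& sub_ones c AB.1, even_odd n AB.1, sub_gt1 c AB.2,
            (2 <= card_mask AB.1 + card_mask AB.2)%N & noEO s AB.2]] in
    let t3 := flatten
      [seq rmul_word (scale_nc ((-1) ^+ (card_mask AB.2))
                               (Dfuel fuel' (reduce c AB.1 AB.2)))
                     (yx_pow (card_mask AB.1 + card_mask AB.2).-1)
      | AB <- mask_pairs n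
      & [&& sub_ones c AB.1, odd_even n AB.1, sub_gt1 c AB.2,
            (2 <= card_mask AB.1 + card_mask AB.2)%N & noOE s AB.2]] in
    t1 ++ t2 ++ t3
  end.

(* frak D(c) = D(y^{c_1} x^{c_2} ... y^{c_{2s-1}} x^{c_{2s}});
   fuel = weight suffices since each recursive call strictly lowers the weight. *)
Definition Dfrak (c : seq nat) : ncpoly := Dfuel (sumn c) c.

Fixpoint lhs_index (c : seq nat) : seq nat :=
  match c with
  | a :: b :: rest => nseq a.-1 1%N ++ b.+1 :: lhs_index rest
  | _ => [::]
  end.

(* Main.v *)
Require Import Defs.
From HB Require Import structures.
From mathcomp Require Import all_boot all_order all_algebra.
From mathcomp Require Import all_classical all_reals all_analysis.
From mathcomp Require Import ring lra zify.
Set Implicit Arguments. Unset Strict Implicit. Unset Printing Implicit Defensive.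
Import Order.TTheory GRing.Theory Num.Theory.
Import numFieldNormedType.Exports.
Local Open Scope ring_scope.

(** For n >= 0 let S_n(c) be the sum over chains of indices in [1, n], one for
    each letter of y^{c_1} x^{c_2} ... x^{c_{2s}}, of the product of the weights
    1/j (letter x) and 1/(n + 1 - j) (letter y); consecutive indices weakly
    increase, except that they strictly increase from an x to the next y.

    Put N = n + 1.  After shifting the y-indices of S_N by one, both S_N and S_n
    use the weights x_j = 1/j and y_j = 1/(N - j), which satisfy
    x_j y_j = (x_j + y_j) / N for 0 < j < N.  Hence the difference between a weak
    and a strict inequality at a boundary between two blocks is a sum in which one
    of the two exponents drops by 1, with a factor 1/N.  Consequently the signed
    even-odd sum of S_N and the signed odd-even sum of S_n are both equal to the
    same sum over chains that are strict at every block boundary and in which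
    blocks of length 1 may be omitted at the price of a factor 1/N.  This identity is the
    recursion for D read on truncated sums: S_n(c) is the truncation at n of
    Z(D(c)), whose words only involve exponents >= 2.

    On the other side, requiring strict inequalities also before each y of a block
    gives exactly the truncation at n of zeta({1}^{c_1-1}, c_2+1, ...), by a
    connected-sum argument with connector 'C(m, k) / 'C(n, k).  The two sums differ
    by O(H_n^p / n), where H_n is the harmonic number, so they have the same limit. *)

(** * Chains of blocks *)

Section Blocks.
Variable R : numFieldType.
Implicit Types (w x y : nat -> R) (h g : nat -> R) (T : (nat -> R) -> nat -> R).

Definition wsum w h m := \sum_(1 <= j < m.+1) w j * h j.
Definition ssum w h m := \sum_(1 <= j < m.+1) w j * h j.-1.

Lemma wsum0 w h : wsum w h 0%N = 0. Proof. by rewrite /wsum big_geq. Qed.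
Lemma ssum0 w h : ssum w h 0%N = 0. Proof. by rewrite /ssum big_geq. Qed.
Lemma wsumS w h m : wsum w h m.+1 = wsum w h m + w m.+1 * h m.+1.
Proof. by rewrite /wsum big_nat_recr. Qed.
Lemma ssumS w h m : ssum w h m.+1 = ssum w h m + w m.+1 * h m.
Proof. by rewrite /ssum big_nat_recr. Qed.

Lemma wsum_shift w g : wsum w g = ssum w (fun m => g m.+1).
Proof.
by apply/funext; elim=> [|m IH]; rewrite ?wsum0 ?ssum0 // wsumS ssumS IH.
Qed.

(** Linearity in the shape [h + k * g], so that the signed combinations in [oe] pass through nested
    sums by rewriting alone. *)
Definition affine_op T := forall k h g,
  T (fun m => h m + k * g m) = fun m => T h m + k * T g m.

Lemma wsum_affine w : affine_op (wsum w).
Proof.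
move=> k h g; apply/funext; elim=> [|m IH]; rewrite ?wsum0 ?wsumS ?IH; ring.
Qed.

Lemma ssum_affine w : affine_op (ssum w).
Proof.
move=> k h g; apply/funext; elim=> [|m IH]; rewrite ?ssum0 ?ssumS ?IH; ring.
Qed.

Lemma iter_affine T i : affine_op T -> affine_op (iter i T).
Proof. by move=> TA; elim: i => [|i IH] k h g //=; rewrite IH TA. Qed.

(* A block of a equal letters of weight w, appended to chains counted by h: its first index
   lies strictly (sblk) or weakly (wblk) above the previous one. *)
Definition sblk w a h := iter a.-1 (wsum w) (ssum w h).
Definition wblk w a h := iter a.-1 (wsum w) (wsum w h).

Lemma sblk_affine w a : affine_op (sblk w a).
Proof. by move=> k h g; rewrite /sblk ssum_affine iter_affine//; apply: wsum_affine. Qed.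
Lemma wblk_affine w a : affine_op (wblk w a).
Proof. by move=> k h g; rewrite /wblk wsum_affine iter_affine//; apply: wsum_affine. Qed.

Definition pair_blk x y a b h := wblk x b (sblk y a h).

Lemma pair_blk_affine x y a b : affine_op (pair_blk x y a b).
Proof. by move=> k h g; rewrite /pair_blk sblk_affine wblk_affine. Qed.

Lemma sblkSS w a h : sblk w a.+2 h = wsum w (sblk w a.+1 h). Proof. by []. Qed.
Lemma wblk_iter w a h : wblk w a.+1 h = iter a.+1 (wsum w) h.
Proof. by rewrite iterSr. Qed.

Definition hat (q : R) w a h m := sblk w a h m + (if a == 1%N then q else 0) * h m.

Lemma hat1 q w h m : hat q w 1%N h m = ssum w h m + q * h m. Proof. by []. Qed.
Lemma hatSS q w a h : hat q w a.+2 h = sblk w a.+2 h.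
Proof. by apply/funext => m; rewrite /hat /= mul0r addr0. Qed.

(** The weak sum exceeds the strict one by its diagonal, where [x j * y j] becomes
    [q * (x j + y j)]: the two indices merge into one that keeps either letter. *)
Lemma wsum_ssum q x y h : (forall j, x j.+1 * y j.+1 = q * (x j.+1 + y j.+1)) ->
  wsum x (ssum y h) = fun m => ssum x (hat q y 1%N h) m + q * ssum y h m.
Proof.
move=> xy; apply/funext; elim=> [|m IH]; first by rewrite wsum0 !ssum0; ring.
by rewrite wsumS !ssumS IH mulrDr mulrA xy hat1; ring.
Qed.

Lemma wsum_wsum q x y h : (forall j, x j.+1 * y j.+1 = q * (x j.+1 + y j.+1)) ->
  wsum x (wsum y h) = fun m => (ssum x (wsum y h) m + q * wsum x h m) + q * wsum y h m.
Proof.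
move=> xy; apply/funext; elim=> [|m IH]; first by rewrite !wsum0 ssum0; ring.
by rewrite wsumS ssumS IH !wsumS mulrDr mulrA xy; ring.
Qed.

(** Passing from a weak to a strict inner boundary subtracts the diagonal, hence the two terms with
    one exponent lowered. When the lowered exponent would be 0, the diagonal term stays and is
    exactly the omission option in [hat]; omitting both blocks costs [q ^+ 2]. *)
Lemma pair_blk_hat q x y a b h : (forall j, x j.+1 * y j.+1 = q * (x j.+1 + y j.+1)) ->
  (0 < a)%N -> (0 < b)%N ->
  hat q x b (hat q y a h) = fun m =>
    pair_blk x y a b h m
    + (- (if (1 < a)%N then q else 0)) * pair_blk x y a.-1 b h m
    + (- (if (1 < b)%N then q else 0)) * pair_blk x y a b.-1 h m
    + (if (a == 1%N) && (b == 1%N) then q ^+ 2 else 0) * h m.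
Proof.
move=> xy.
case: a => [//|[|a]] _; case: b => [//|[|b]] _; apply/funext => m.
- by rewrite hat1 /pair_blk /wblk /sblk /= (wsum_ssum _ xy) hat1; ring.
- rewrite hatSS /pair_blk [wblk x b.+2.-1 _]wblk_iter /wblk {1}/sblk.
  move: (iter_affine b.+1 (wsum_affine x)); rewrite [b.+2.-1]/= [1.-1%N]/=.
  move: (iter _ _) => K KA; rewrite [sblk y 1 h]/(ssum y h) (wsum_ssum _ xy) KA /=; ring.
- rewrite hatSS hat1 /pair_blk /wblk [iter _ _]/= [a.+2.-1]/=.
  rewrite [wsum x (sblk y a.+2 h)](wsum_wsum _ xy) /= -sblkSS; ring.
- rewrite !hatSS /pair_blk [wblk x b.+2.-1 _]wblk_iter /wblk {1}/sblk.
  move: (iter_affine b.+1 (wsum_affine x)); rewrite [b.+2.-1]/= [a.+2.-1]/=.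
  move: (iter _ _) => K KA; rewrite [in RHS](wsum_wsum (sblk y a.+1 h) xy) !KA /=.
  ring.
Qed.

Fixpoint chain x y (c : seq nat) h : nat -> R :=
  match c with
  | a :: b :: c' => chain x y c' (pair_blk x y a b h)
  | [:: a] => sblk y a h
  | [::] => h
  end.

Fixpoint hats (q : R) x y (c : seq nat) h : nat -> R :=
  if c is a :: c' then hats q y x c' (hat q y a h) else h.

(* The odd-even sum of the recursion, organised by consecutive pairs; q stands for 1 / N.
   Allowing odd size makes it usable for the even-odd sum as well, see [eo]. *)
Fixpoint oe (q : R) (c : seq nat) (phi : seq nat -> R) : R :=
  match c with
  | [::] => phi [::]
  | [:: a] => phi [:: a] + (- (if (1 < a)%N then q else 0)) * phi [:: a.-1]
  | a :: b :: c' => oe q c' (fun d =>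
      phi [:: a, b & d]
      + (- (if (1 < a)%N then q else 0)) * phi [:: a.-1, b & d]
      + (- (if (1 < b)%N then q else 0)) * phi [:: a, b.-1 & d]
      + (if (a == 1%N) && (b == 1%N) then q ^+ 2 else 0) * phi d)
  end.

Lemma list2_ind (A : Type) (P : seq A -> Prop) : P [::] -> (forall a, P [:: a]) ->
  (forall a b c, P c -> P [:: a, b & c]) -> forall c, P c.
Proof.
move=> P0 P1 P2 c; suff: P c /\ forall a, P (a :: c) by case.
by elim: c => [|a c [Pc Pac]]; split=> // b; apply: P2.
Qed.

Lemma chain_affine x y c : affine_op (chain x y c).
Proof.
elim/list2_ind: c => [|a|a b c IH] k h g //=; first by rewrite sblk_affine.
by rewrite pair_blk_affine IH.
Qed.

Lemma oe_chain q x y c h n : (forall j, x j.+1 * y j.+1 = q * (x j.+1 + y j.+1)) ->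
  all (fun k => 0 < k)%N c -> ~~ odd (size c) ->
  oe q c (fun d => chain x y d h n) = hats q x y c h n.
Proof.
move=> xy; elim/list2_ind: c h => [|a|a b c IH] h //= /and3P[a0 b0 c0].
rewrite negbK => sc; rewrite -IH // (pair_blk_hat _ xy) //.
by congr oe; apply/funext => d; rewrite !chain_affine.
Qed.

(* The blocks after the first one at level n + 1, with the y-indices shifted by one: only
   the last x-block can reach the index n + 1, hence its separate weight x'. *)
Fixpoint tail_chain x y x' n (c : seq nat) h : R :=
  match c with
  | b :: a :: c' => tail_chain x y x' n c' (pair_blk y x b a h)
  | [:: b] => sblk x' b h n.+1
  | [::] => h n
  end.

Lemma tail_chain_affine x y x' n c k h g :
  tail_chain x y x' n c (fun m => h m + k * g m) =
  tail_chain x y x' n c h + k * tail_chain x y x' n c g.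
Proof.
elim/list2_ind: c h g => [|b|b a c IH] h g //=; first by rewrite sblk_affine.
by rewrite pair_blk_affine IH.
Qed.

Lemma eq_sblk w w' a h n : (forall j, (0 < j <= n)%N -> w j = w' j) ->
  forall m, (m <= n)%N -> sblk w a h m = sblk w' a h m.
Proof.
move=> ww'; rewrite /sblk; elim: a.-1 => [|i IH] /=.
- elim=> [|m IHm] mn; first by rewrite !ssum0.
  by rewrite !ssumS IHm ?(ltnW mn)// ww'.
- elim=> [|m IHm] mn; first by rewrite !wsum0.
  by rewrite !wsumS IHm ?(ltnW mn)// ww'// IH.
Qed.

Lemma eq_wsum w h h' n : (forall j, (n < j)%N -> w j = 0) ->
  (forall m, (m <= n)%N -> h m = h' m) -> wsum w h = wsum w h'.
Proof.
move=> w0 hh'; apply/funext; elim=> [|m IH]; first by rewrite !wsum0.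
rewrite !wsumS IH; case: (leqP m.+1 n) => mn; first by rewrite hh'.
by rewrite w0 // !mul0r.
Qed.

(** * Passing from level n to level n + 1 *)

Section LevelStep.
Variables (q : R) (n : nat) (x y x' : nat -> R).
Hypothesis xy : forall j, x j.+1 * y j.+1 = q * (x j.+1 + y j.+1).
Hypothesis xx' : forall j, (0 < j <= n)%N -> x' j = x j.
Hypothesis x'n : x' n.+1 = q.
Hypothesis yn : forall j, (n < j)%N -> y j = 0.

(** Split according to whether the largest index is n + 1, which has weight [q]. For length at least
    2 these chains cancel against the signed term; for length 1 they are the omission term of
    [hat]. *)
Lemma sblk_last b h :
  sblk x' b.+1 h n.+1 + (- (if (1 < b.+1)%N then q else 0)) * sblk x' b h n.+1 =
  hat q x b.+1 h n.
Proof.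
rewrite /hat -(eq_sblk b.+1 h xx') //.
case: b => [|b] /=; first by rewrite /sblk /= ssumS x'n; ring.
by rewrite !sblkSS wsumS x'n; ring.
Qed.

Lemma oe_tail_chain c h : all (fun k => 0 < k)%N c -> odd (size c) ->
  oe q c (fun d => tail_chain x y x' n d h) = hats q y x c h n.
Proof.
have yx j : y j.+1 * x j.+1 = q * (y j.+1 + x j.+1) by rewrite mulrC xy addrC.
elim/list2_ind: c h => [|b|b a c IH] h //=.
  by case: b => // b _ _; rewrite sblk_last.
move=> /and3P[b0 a0 c0]; rewrite negbK => sc; rewrite -IH // (pair_blk_hat _ yx) //.
by congr oe; apply/funext => d; rewrite !tail_chain_affine.
Qed.

Variable y' : nat -> R.
Hypothesis y'S : forall j, y' j.+2 = y j.+1.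
Hypothesis y'1 : y' 1%N = q.

Lemma wsum_y' g m : wsum y' g m.+1 = q * g 1%N + wsum y (fun k => g k.+1) m.
Proof.
elim: m => [|m IH]; first by rewrite wsumS !wsum0 y'1; ring.
by rewrite wsumS IH wsumS y'S; ring.
Qed.

Lemma ssum_y' g m : ssum y' g m.+1 = q * g 0%N + wsum y g m.
Proof.
elim: m => [|m IH]; first by rewrite ssumS ssum0 wsum0 y'1; ring.
by rewrite ssumS IH wsumS y'S; ring.
Qed.

(** Lowering the y-indices by one makes the strict inequality weak; the chains through index 1
    vanish because [g 0 = 0]. *)
Lemma sblk_y' a g : g 0%N = 0 -> (fun m => sblk y' a g m.+1) = wblk y a g.
Proof.
move=> g0; rewrite /sblk /wblk; elim: a.-1 => [|i IH] /=.
  by apply/funext => m; rewrite ssum_y' g0; ring.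
apply/funext => m; rewrite wsum_y' IH; have := congr1 (@^~ 0%N) IH => /= ->.
by rewrite -iterS iterSr; case: i {IH} => [|i] /=; rewrite wsum0; ring.
Qed.

(** The shift of the y-indices turns x < y into a weak inequality and the weak y-to-x boundary into
    a strict one. The natural pairs become (x, y), which is where the even-odd pairing comes
    from. *)
Lemma chain_tail a c h :
  chain x' y' (a :: c) h n.+1 = tail_chain x y x' n c (fun m => sblk y' a h m.+1).
Proof.
elim/list2_ind: c a h => [|b|b d c IH] a h //.
  by rewrite /= /pair_blk /wblk wsum_shift.
rewrite [LHS]IH /=; congr (tail_chain _ _ _ _ _ _).
rewrite /pair_blk /wblk wsum_shift -/(sblk _ _ _) sblk_y'; last first.
  by rewrite /sblk; case: b.-1 => [|i]; rewrite /= ?ssum0 ?wsum0.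
rewrite /wblk; congr iter; apply: eq_wsum yn _ => m mn.
exact: (eq_sblk _ _ xx').
Qed.

(** Mirror image of [sblk_last]: here the split is on whether the smallest index is 1. As blocks
    grow at their upper end, the splitting [E2] needs an induction on the length. *)
Lemma sblk_first a : (0 < a)%N ->
  (fun m => sblk y' a (fun=> 1) m.+1
     + (- (if (1 < a)%N then q else 0)) * sblk y' a.-1 (fun=> 1) m.+1) =
  hat q y a (fun=> 1).
Proof.
case: a => // a _.
have E1 m : sblk y' 1%N (fun=> 1) m.+1 = sblk y 1%N (fun=> 1) m + q.
  by rewrite /sblk /= ssum_y' wsum_shift; ring.
have step a' m : sblk y' a'.+2 (fun=> 1) m.+1 =
    q * sblk y' a'.+1 (fun=> 1) 1%N + wsum y (fun k => sblk y' a'.+1 (fun=> 1) k.+1) m.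
  by rewrite sblkSS wsum_y'.
have z a' : sblk y a' (fun=> 1) 0%N = 0.
  by rewrite /sblk; case: a'.-1 => [|i]; rewrite /= ?ssum0 ?wsum0.
suff E2 a' m : sblk y' a'.+2 (fun=> 1) m.+1 =
    sblk y a'.+2 (fun=> 1) m + q * sblk y' a'.+1 (fun=> 1) m.+1.
  apply/funext => m; case: a => [|a]; first by rewrite E1 /hat /=; ring.
  by rewrite hatSS E2 /=; ring.
elim: a' m => [|a' IH] m.
  rewrite step; have -> : (fun k => sblk y' 1%N (fun=> 1) k.+1) =
      fun k => sblk y 1%N (fun=> 1) k + q * 1.
    by apply/funext => k; rewrite E1 mulr1.
  rewrite wsum_affine !E1 z sblkSS.
  have -> : wsum y (fun=> 1) = sblk y 1%N (fun=> 1) by rewrite wsum_shift.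
  ring.
rewrite step.
have -> : (fun k => sblk y' a'.+2 (fun=> 1) k.+1) = fun k =>
    sblk y a'.+2 (fun=> 1) k + q * sblk y' a'.+1 (fun=> 1) k.+1.
  by apply/funext => k; rewrite IH.
by rewrite wsum_affine (IH 0%N) z step -sblkSS; ring.
Qed.

(** Even-odd pairs are (2,3), (4,5), ...: the first block stands alone here, and the last one is the
    odd leftover of [oe]. *)
Definition eo (c : seq nat) (phi : seq nat -> R) : R :=
  if c is a :: c' then
    oe q c' (fun d => phi (a :: d) + (- (if (1 < a)%N then q else 0)) * phi (a.-1 :: d))
  else phi [::].

(** Both sides equal [hats q x y c], the sum over strict chains with optional omission of blocks of
    length 1. *)
Lemma eo_chain c : all (fun k => 0 < k)%N c -> ~~ odd (size c) -> c != [::] ->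
  eo c (fun d => chain x' y' d (fun=> 1) n.+1) =
  oe q c (fun d => chain x y d (fun=> 1) n).
Proof.
move=> c0 sc; rewrite oe_chain //; case: c c0 sc => // a c /andP[a0 c0].
move=> sc _; have {}sc : odd (size c) by rewrite /= negbK in sc.
rewrite [RHS]/= -sblk_first // -oe_tail_chain // /eo.
by congr oe; apply/funext => d; rewrite !chain_tail tail_chain_affine.
Qed.
End LevelStep.

End Blocks.

(** * Signed sums over masks *)

Section Masks.
Local Open Scope nat_scope.

Lemma all_iotaS (p : pred nat) n :
  all p (iota 1 n.+1) = p 1 && all (fun i => p i.+1) (iota 1 n).
Proof. by rewrite /= (iotaDl 1 1) all_map. Qed.

Lemma eq_all_iota (p p' : pred nat) n : (forall i, 0 < i -> p i = p' i) ->
  all p (iota 1 n) = all p' (iota 1 n).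
Proof. by move=> pp'; apply: eq_in_all => i; rewrite mem_iota => /andP[/pp']. Qed.

Lemma inA_cons a A i : 0 < i -> inA (a :: A) i.+1 = inA A i.
Proof. by case: i. Qed.

Lemma sub_ones_cons k c a A :
  sub_ones (k :: c) (a :: A) = (a ==> (k == 1)) && sub_ones c A.
Proof.
rewrite /sub_ones all_iotaS; congr andb; apply: eq_all_iota => i i0.
by rewrite inA_cons//; case: i i0.
Qed.

Lemma sub_gt1_cons k c a A :
  sub_gt1 (k :: c) (a :: A) = (a ==> (1 < k)) && sub_gt1 c A.
Proof.
rewrite /sub_gt1 all_iotaS; congr andb; apply: eq_all_iota => i i0.
by rewrite inA_cons//; case: i i0.
Qed.

Lemma odd_even_cons2 n a b A : odd_even n.+2 [:: a, b & A] = (a == b) && odd_even n A.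
Proof.
rewrite /odd_even !all_iotaS andbA; congr andb; first by case: a; case: b; reflexivity.
apply: eq_all_iota => -[|[|i]] //= _; rewrite !negbK.
by rewrite /inA.
Qed.

(** Position 1 cannot lie in an even-odd set, since position 0 would have to as well and [inA A 0]
    is false. Deleting it exchanges the parities. *)
Lemma even_odd_cons n a A : even_odd n.+1 (a :: A) = ~~ a && odd_even n A.
Proof.
rewrite /even_odd all_iotaS; congr andb.
by apply: eq_all_iota => -[|[|i]] //= _; rewrite !negbK.
Qed.

Lemma noOE_cons2 s a b B : noOE s.+1 [:: a, b & B] = ~~ (a && b) && noOE s B.
Proof.
rewrite /noOE all_iotaS; congr andb; apply: eq_all_iota => -[|r] // _.
by rewrite !mulnS.
Qed.

Lemma noEO_cons s b B : noEO s (b :: B) = noOE s.-1 B.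
Proof. by apply: eq_all_iota => -[|r] // _; rewrite !mulnS. Qed.

Lemma reduce_cons k c a A b B : reduce (k :: c) (a :: A) (b :: B) =
  if a then reduce c A B else (k - b) :: reduce c A B.
Proof.
have E : [seq nth 0 (k :: c) i.-1 - inA (b :: B) i |
    i <- iota 2 (size c) & ~~ inA (a :: A) i] = reduce c A B.
  rewrite (iotaDl 1 1) filter_map -map_comp /reduce.
  have -> : [seq i <- iota 1 (size c) | preim (addn 1) (fun i => ~~ inA (a :: A) i) i]
     = [seq i <- iota 1 (size c) | ~~ inA A i].
    by apply: eq_in_filter => i; rewrite mem_iota => /andP[i0 _] /=; rewrite inA_cons.
  apply/eq_in_map => i; rewrite mem_filter mem_iota => /and3P[_ i0 _].
  by case: i i0.
by rewrite -E /reduce /=; case: (a).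
Qed.

Lemma reduce_nil : reduce [::] [::] [::] = [::]. Proof. by []. Qed.

Lemma size_allmasks n A : A \in allmasks n -> size A = n.
Proof.
elim: n A => [|n IH] A; first by rewrite inE => /eqP ->.
by move=> /allpairsP[[b m] /= [_ /IH <- ->]].
Qed.
End Masks.

Section MaskSum.
Variable R : numFieldType.

Definition mask_sum n (P : rel (seq bool)) (F : seq bool -> seq bool -> R) :=
  \sum_(A <- allmasks n) \sum_(B <- allmasks n | P A B) F A B.

Lemma big_allmasksS n (P : pred (seq bool)) (F : seq bool -> R) :
  \sum_(A <- allmasks n.+1 | P A) F A =
  \sum_(A <- allmasks n | P (false :: A)) F (false :: A) +
  \sum_(A <- allmasks n | P (true :: A)) F (true :: A).
Proof. by rewrite /= cats0 big_cat !big_map. Qed.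

Lemma mask_sumS n P F : mask_sum n.+1 P F =
  (mask_sum n (fun A B => P (false :: A) (false :: B)) (fun A B => F (false :: A) (false :: B))
  + mask_sum n (fun A B => P (false :: A) (true :: B)) (fun A B => F (false :: A) (true :: B)))
  + (mask_sum n (fun A B => P (true :: A) (false :: B)) (fun A B => F (true :: A) (false :: B))
  + mask_sum n (fun A B => P (true :: A) (true :: B)) (fun A B => F (true :: A) (true :: B))).
Proof.
rewrite /mask_sum big_allmasksS.
by congr (_ + _); rewrite -big_split; apply: eq_bigr => A _; rewrite big_allmasksS.
Qed.

Lemma mask_sum0 P F : mask_sum 0 P F = if P [::] [::] then F [::] [::] else 0.
Proof. by rewrite /mask_sum /= big_seq1 big_mkcond big_seq1. Qed.

Lemma eq_mask_sum_size n (P P' : rel (seq bool)) (F F' : seq bool -> seq bool -> R) :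
  (forall A B, size A = n -> size B = n -> P A B = P' A B) ->
  (forall A B, size A = n -> size B = n -> P A B -> F A B = F' A B) ->
  mask_sum n P F = mask_sum n P' F'.
Proof.
move=> PP' FF'; rewrite /mask_sum; apply: eq_big_seq => A /size_allmasks sA.
rewrite big_mkcond [RHS]big_mkcond; apply: eq_big_seq => B /size_allmasks sB.
by rewrite -PP' //; case: ifP => // PAB; rewrite FF'.
Qed.

Lemma eq_mask_sum n (P P' : rel (seq bool)) (F F' : seq bool -> seq bool -> R) :
  P =2 P' -> (forall A B, P A B -> F A B = F' A B) -> mask_sum n P F = mask_sum n P' F'.
Proof. by move=> PP' FF'; apply: eq_mask_sum_size => A B _ _; [exact: PP' | exact: FF']. Qed.

Lemma mask_sumZ n (p : bool) (P : rel (seq bool)) k (F : seq bool -> seq bool -> R) :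
  mask_sum n (fun A B => p && P A B) (fun A B => k * F A B) =
  (if p then k else 0) * mask_sum n P F.
Proof.
rewrite /mask_sum mulr_sumr; apply: eq_bigr => A _; case: p => /=.
  by rewrite mulr_sumr.
by rewrite big_pred0 // mul0r.
Qed.

Lemma mask_sum_affine n (P : rel (seq bool)) k (F G : seq bool -> seq bool -> R) :
  mask_sum n P (fun A B => F A B + k * G A B) = mask_sum n P F + k * mask_sum n P G.
Proof.
rewrite /mask_sum mulr_sumr -big_split; apply: eq_bigr => A _ /=.
by rewrite mulr_sumr -big_split.
Qed.

(** The bounds on #A + #B are left out, so that the conditions decouple over consecutive pairs;
    [mask_sum_split] and [mask_sum_split1] restore them. *)
Definition oeP (c : seq nat) (A B : seq bool) :=
  [&& sub_ones c A, odd_even (size c) A, sub_gt1 c B & noOE (size c)./2 B].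
Definition eoP (c : seq nat) (A B : seq bool) :=
  [&& sub_ones c A, even_odd (size c) A, sub_gt1 c B & noEO (size c)./2 B].
Definition mterm (q : R) c phi (A B : seq bool) : R :=
  (-1) ^+ card_mask B * q ^+ (card_mask A + card_mask B) * phi (reduce c A B).

Lemma oeP_cons2 k l c a a' A b b' B :
  oeP [:: k, l & c] [:: a, a' & A] [:: b, b' & B] =
  [&& a == a', (a ==> (k == 1)%N && (l == 1)%N), (b ==> (1 < k)%N), (b' ==> (1 < l)%N)
    & ~~ (b && b')] && oeP c A B.
Proof.
rewrite /oeP !sub_ones_cons !sub_gt1_cons odd_even_cons2 noOE_cons2.
case: (sub_ones c A); case: (odd_even _ A); case: (sub_gt1 c B); case: (noOE _ B);
  by case: a a' b b' (k == 1%N) (l == 1%N) (1 < k)%N (1 < l)%N =>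
    [] [] [] [] [] [] [] [].
Qed.

Lemma mask_sum_oe q c phi : mask_sum (size c) (oeP c) (mterm q c phi) = oe q c phi.
Proof.
elim/list2_ind: c phi => [|a|a b c IH] phi.
- by rewrite mask_sum0 /mterm /= expr0 !mul1r.
- rewrite mask_sumS !mask_sum0 /oeP !sub_ones_cons !sub_gt1_cons /= /mterm.
  rewrite !reduce_cons reduce_nil subn0 subn1 /= !andbT !andbF !addr0.
  by case: (1 < a)%N => /=; ring.
(* [T] fixes the first two entries of both masks and [C] is the resulting local condition. Twelve of
   the sixteen choices always violate [C]; the other four are the four terms of [oe]. *)
- pose T x x' y y' := mask_sum (size c)
    (fun A B => oeP [:: a, b & c] [:: x, x' & A] [:: y, y' & B])
    (fun A B => mterm q [:: a, b & c] phi [:: x, x' & A] [:: y, y' & B]).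
  pose C x x' y y' := [&& x == x', x ==> (a == 1%N) && (b == 1%N), y ==> (1 < a)%N,
    y' ==> (1 < b)%N & ~~ (y && y')].
  have TE x x' y y' (k : R) psi :
      (forall A B, mterm q [:: a, b & c] phi [:: x, x' & A] [:: y, y' & B] =
        k * mterm q c psi A B) ->
      T x x' y y' = (if C x x' y y' then k else 0) * mask_sum (size c) (oeP c) (mterm q c psi).
    move=> EF; rewrite -mask_sumZ; apply: eq_mask_sum => A B; first exact: oeP_cons2.
    by move=> _; apply: EF.
  have T0 x x' y y' : ~~ C x x' y y' -> T x x' y y' = 0.
    move=> nC; rewrite /T /mask_sum big1 // => A _; rewrite big_pred0 // => B.
    by rewrite oeP_cons2 -/(C x x' y y') (negbTE nC).
  have E1 : T false false false false = _ * _ := TE _ _ _ _ 1 (fun d => phi [:: a, b & d]) _.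
  have E2 : T false false true false = _ * _ :=
    TE _ _ _ _ (- q) (fun d => phi [:: a.-1, b & d]) _.
  have E3 : T false false false true = _ * _ :=
    TE _ _ _ _ (- q) (fun d => phi [:: a, b.-1 & d]) _.
  have E4 : T true true false false = _ * _ := TE _ _ _ _ (q ^+ 2) phi _.
  have -> : mask_sum (size [:: a, b & c]) (oeP [:: a, b & c])
      (mterm q [:: a, b & c] phi) =
      ((T false false false false + T false false true false) +
       T false false false true) + T true true false false.
    rewrite [size _]/= !mask_sumS -!/(T _ _ _ _).
    rewrite (T0 true false) // (T0 true false) // (T0 true false) // (T0 true false) //.
    rewrite (T0 false true) // (T0 false true) // (T0 false true) // (T0 false true) //.
    rewrite (T0 false false true true) ?(T0 true true true true) //; last by rewrite /C /= !andbF.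
    rewrite (T0 true true true false) ?(T0 true true false true) //.
    - ring.
    - by rewrite /C; case: (a) (b) => [|[|?]] [|[|?]].
    - by rewrite /C; case: (a) (b) => [|[|?]] [|[|?]].
    - by rewrite /C /= !andbF.
  rewrite E1 ?E2 ?E3 ?E4 => [|A B|A B|A B|A B].
  - rewrite /= -IH {3}[mterm]lock.
    have -> F1 F2 F3 F4 k2 k3 k4 : mterm q c (fun d => F1 d + k2 * F2 d + k3 * F3 d + k4 * F4 d) =
      fun A B => mterm q c F1 A B + k2 * mterm q c F2 A B + k3 * mterm q c F3 A B
        + k4 * mterm q c F4 A B.
      by apply/funext => A; apply/funext => B; rewrite /mterm; ring.
    rewrite -lock !mask_sum_affine;
    rewrite /C /= !andbT.
    by case: (1 < a)%N; case: (1 < b)%N; case: (_ && _); ring.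
  - by rewrite /mterm !reduce_cons /card_mask /= !add0n !addSn !exprS; ring.
  - by rewrite /mterm !reduce_cons /card_mask /= !add0n !subn0 subn1 ?add1n !addnS !exprS; ring.
  - by rewrite /mterm !reduce_cons /card_mask /= !add0n !subn0 subn1 ?add1n !addnS !exprS; ring.
  - by rewrite /mterm !reduce_cons /card_mask /= !add0n !subn0 mul1r.
Qed.

Lemma eoP_cons k c a A b B : odd (size c) ->
  eoP (k :: c) (a :: A) (b :: B) = (~~ a && (b ==> (1 < k)%N)) && oeP c A B.
Proof.
move=> sc; rewrite /eoP /oeP sub_ones_cons sub_gt1_cons even_odd_cons noEO_cons.
have -> : ((size (k :: c))./2.-1 = (size c)./2)%N by rewrite /= uphalf_half sc.
by case: a; case: b => /=; rewrite ?andbF //; case: (1 < k)%N; rewrite ?andbF.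
Qed.

Lemma mask_sum_eo q c phi : c != [::] -> ~~ odd (size c) ->
  mask_sum (size c) (eoP c) (mterm q c phi) = eo q c phi.
Proof.
case: c => // a c _; rewrite [size _]/= [odd _]/= negbK => sc.
have E y (k : R) psi : (forall A B, mterm q (a :: c) phi (false :: A) (y :: B) =
      k * mterm q c psi A B) ->
    mask_sum (size c) (fun A B => eoP (a :: c) (false :: A) (y :: B))
      (fun A B => mterm q (a :: c) phi (false :: A) (y :: B)) =
    (if y ==> (1 < a)%N then k else 0) * mask_sum (size c) (oeP c) (mterm q c psi).
  move=> EF; rewrite -mask_sumZ; apply: eq_mask_sum => A B; first exact: eoP_cons.
  by move=> _; apply: EF.
rewrite mask_sumS (E false 1 (fun d => phi (a :: d))) => [|A B]; last first.
  by rewrite /mterm !reduce_cons /card_mask /= !add0n !subn0 mul1r.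
rewrite (E true (- q) (fun d => phi (a.-1 :: d))) => [|A B]; last first.
  by rewrite /mterm !reduce_cons /card_mask /= !add0n subn1 ?add1n !addnS !exprS; ring.
have T0 y : mask_sum (size c) (fun A B => eoP (a :: c) (true :: A) (y :: B))
      (fun A B => mterm q (a :: c) phi (true :: A) (y :: B)) = 0.
  by rewrite /mask_sum big1 // => A _; rewrite big_pred0 // => B; rewrite eoP_cons.
rewrite !T0 /eo -mask_sum_oe.
have -> : mterm q c (fun d => phi (a :: d) + (- (if (1 < a)%N then q else 0)) * phi (a.-1 :: d))
  = fun A B => mterm q c (fun d => phi (a :: d)) A B + (- (if (1 < a)%N then q else 0)) *
      mterm q c (fun d => phi (a.-1 :: d)) A B.
  by apply/funext => A; apply/funext => B; rewrite /mterm; ring.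
by rewrite mask_sum_affine /=; case: (1 < a)%N; ring.
Qed.

End MaskSum.

(** * Cardinalities of masks and size of the reduced index *)

Section MaskFacts.
Local Open Scope nat_scope.

Lemma card_mask_gt0 A i : inA A i -> 0 < card_mask A.
Proof.
case: i => // i; rewrite /inA /card_mask /=.
by elim: A i => [|a A IH] [|i] //=; [case: a | move/IH; lia].
Qed.

Lemma card_mask_gt1 A i : inA A i -> inA A i.+1 -> 1 < card_mask A.
Proof.
elim: A i => [|a A IH] [|[|i]] //; rewrite /card_mask /=.
  by rewrite /inA /= => -> /= A0; have := @card_mask_gt0 A 1 A0; rewrite /card_mask; lia.
by move=> h1 h2; have := IH i.+1 h1 h2; rewrite /card_mask; lia.
Qed.

Lemma noOE_le1 s B : card_mask B <= 1 -> noOE s B.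
Proof.
move=> B1; apply/allP => -[|r] //; rewrite mulnS /= => _.
apply/negP => /andP[h1 h2]; by have := card_mask_gt1 h1 h2; lia.
Qed.

Lemma noEO_le1 s B : card_mask B <= 1 -> noEO s B.
Proof.
move=> B1; apply/allP => r _.
apply/negP => /andP[h1 h2]; by have := card_mask_gt1 h1 h2; lia.
Qed.

(** The set is a union of pairs {2r-1, 2r}. This keeps the depth of the reduced index even. *)
Lemma odd_even_card n A : size A = n -> odd_even n A -> ~~ odd (card_mask A).
Proof.
elim/list2_ind: A n => [|a|a b A IH] [|[|n]] //=.
  by case: a.
by move=> [sA]; rewrite odd_even_cons2 /card_mask /= => /andP[/eqP <- /(IH _ sA)]; rewrite addnA oddD addnn odd_double.
Qed.

Lemma even_odd_card n A : size A = n -> even_odd n A -> ~~ odd (card_mask A).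
Proof.
case: A n => [|a A] [|n] // [sA]; rewrite even_odd_cons => /andP[/negbTE -> ].
exact: odd_even_card.
Qed.

Lemma odd_even_card0 n A : card_mask A = 0 -> odd_even n A.
Proof.
move=> A0; have h i : inA A i = false.
  by apply/negP => /card_mask_gt0; rewrite A0.
by apply/allP => i _; rewrite !h !andbF.
Qed.

Lemma even_odd_card0 n A : card_mask A = 0 -> even_odd n A.
Proof.
move=> A0; have h i : inA A i = false.
  by apply/negP => /card_mask_gt0; rewrite A0.
by apply/allP => i _; rewrite !h !andbF.
Qed.

(** An admissible A has even cardinality, so A is empty and B is a singleton, for which both
    adjacency conditions are vacuous. *)
Lemma oeP_eoP_card1 c A B : size A = size c -> card_mask A + card_mask B = 1 ->
  oeP c A B = eoP c A B.
Proof.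
move=> sA cAB; rewrite /oeP /eoP noOE_le1 ?noEO_le1; [|lia|lia].
congr andb; congr andb.
case: (posnP (card_mask A)) => [A0|A_gt0].
  by rewrite odd_even_card0 ?even_odd_card0.
have A1 : card_mask A = 1 by lia.
apply/idP/idP => [/(odd_even_card sA)|/(even_odd_card sA)]; by rewrite A1.
Qed.

Lemma reduce_gt0 c A B : size A = size c -> size B = size c -> sub_gt1 c B ->
  all (fun k => 0 < k) c -> all (fun k => 0 < k) (reduce c A B).
Proof.
elim: c A B => [|k c IH] [|a A] [|b B] //= [sA] [sB].
rewrite sub_gt1_cons reduce_cons => /andP[hb hB] /andP[k0 c0].
case: a => /=; rewrite IH //= andbT; by case: b hb => /= hb; rewrite ?subn0 ?subn1 //; by case: (k) hb => [|[|]].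
Qed.

Lemma reduce_sumn c A B : size A = size c -> size B = size c -> sub_gt1 c B ->
  sub_ones c A -> sumn (reduce c A B) + (card_mask A + card_mask B) = sumn c.
Proof.
elim: c A B => [|k c IH] [|a A] [|b B] //= [sA] [sB].
rewrite sub_gt1_cons sub_ones_cons reduce_cons => /andP[hb hB] /andP[ha hA].
rewrite -(IH A B) // /card_mask /=.
move: hb; case: a ha => /= [/eqP ->|_]; case: b => //= hb;
  rewrite ?subn0 ?subn1; case: (k) hb => [|?]; lia.
Qed.

Lemma reduce_size c A B : size A = size c -> size B = size c ->
  size (reduce c A B) + card_mask A = size c.
Proof.
elim: c A B => [|k c IH] [|a A] [|b B] //= [sA] [sB].
rewrite reduce_cons -(IH A B) // /card_mask /=; case: a => /=; lia.
Qed.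

(** The first position survives. Hence a factor x^m in the recursion is only ever appended to words
    starting with y, never to the empty word. *)
Lemma reduce_neq0 c A B : size A = size c -> size B = size c -> c != [::] ->
  even_odd (size c) A -> reduce c A B != [::].
Proof.
case: c A B => [|k c] [|a A] [|b B] // sA sB _.
by rewrite even_odd_cons reduce_cons => /andP[/negbTE ->].
Qed.

Lemma card_mask_nseq n : card_mask (nseq n false) = 0.
Proof. by rewrite /card_mask count_nseq. Qed.

Lemma reduce_nseq c : reduce c (nseq (size c) false) (nseq (size c) false) = c.
Proof. by elim: c => [|k c IH] //=; rewrite reduce_cons IH subn0. Qed.

Lemma sub_ones0 c : sub_ones c (nseq (size c) false).
Proof. by elim: c => [|k c IH] //=; rewrite sub_ones_cons. Qed.
Lemma sub_gt10 c : sub_gt1 c (nseq (size c) false).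
Proof. by elim: c => [|k c IH] //=; rewrite sub_gt1_cons. Qed.

Lemma oeP0 c : oeP c (nseq (size c) false) (nseq (size c) false).
Proof.
by rewrite /oeP sub_ones0 sub_gt10 odd_even_card0 ?noOE_le1 ?card_mask_nseq.
Qed.
Lemma eoP0 c : eoP c (nseq (size c) false) (nseq (size c) false).
Proof.
by rewrite /eoP sub_ones0 sub_gt10 even_odd_card0 ?noEO_le1 ?card_mask_nseq.
Qed.
End MaskFacts.

(** * Separating the terms by #A + #B *)

Section MaskSplit.
Variable R : numFieldType.

Lemma big_allmasks_card0 n (F : seq bool -> R) :
  \sum_(A <- allmasks n | card_mask A == 0%N) F A = F (nseq n false).
Proof.
elim: n F => [|n IH] F; first by rewrite /= big_mkcond big_seq1.
by rewrite big_allmasksS -(IH (fun A => F (false :: A))) [X in _ + X]big_pred0 ?addr0.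
Qed.

Lemma mask_sum_split n (P : rel (seq bool)) (F : seq bool -> seq bool -> R) :
  P (nseq n false) (nseq n false) ->
  mask_sum n P F = F (nseq n false) (nseq n false) +
    mask_sum n (fun A B => P A B && (1 <= card_mask A + card_mask B)%N) F.
Proof.
move=> P0.
have -> : F (nseq n false) (nseq n false) =
    mask_sum n (fun A B => P A B && (card_mask A + card_mask B == 0)%N) F.
  rewrite /mask_sum (bigID (fun A => card_mask A == 0%N)) /= [X in _ + X]big1 ?addr0.
    rewrite big_allmasks_card0 card_mask_nseq -[LHS]big_allmasks_card0.
    rewrite big_mkcond [RHS]big_mkcond; apply: eq_big_seq => B /size_allmasks sB.
    rewrite add0n; case: eqP; rewrite ?andbT ?andbF // => B0.
    suff -> : B = nseq n false by rewrite P0.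
    by rewrite -sB; elim: (B) B0 => //= -[] // B' IH; rewrite /card_mask /= => /IH <-.
  move=> A /negbTE A0; rewrite big_pred0 // => B; rewrite addn_eq0 A0.
  by rewrite andbF.
rewrite /mask_sum -big_split; apply: eq_bigr => A _ /=.
rewrite (bigID (fun B => card_mask A + card_mask B == 0)%N) /=; congr (_ + _).
by apply: eq_bigl => B; rewrite lt0n.
Qed.

Lemma mask_sum_split1 n (P : rel (seq bool)) (F : seq bool -> seq bool -> R) :
  mask_sum n (fun A B => P A B && (1 <= card_mask A + card_mask B)%N) F =
  mask_sum n (fun A B => P A B && (card_mask A + card_mask B == 1)%N) F +
  mask_sum n (fun A B => P A B && (2 <= card_mask A + card_mask B)%N) F.
Proof.
rewrite /mask_sum -big_split; apply: eq_bigr => A _ /=.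
rewrite (bigID (fun B => card_mask A + card_mask B == 1)%N) /=; congr (_ + _).
  by apply: eq_bigl => B; rewrite -andbA; congr andb; lia.
by apply: eq_bigl => B; rewrite -andbA; congr andb; lia.
Qed.

Lemma mterm0 (q : R) c phi : mterm q c phi (nseq (size c) false) (nseq (size c) false) = phi c.
Proof. by rewrite /mterm card_mask_nseq reduce_nseq !expr0 !mul1r. Qed.

(** The left side is the increment of the three sums of the recursion: appending x^m gives
    [q ^+ m * (S1 - S0)], appending y x^(m-1) gives [q ^+ m * S0]. In the even-odd sums [S0]
    survives only for #A + #B = 1, where it completes the odd-even sum; the hypothesis then leaves
    the term of the empty pair. *)
Lemma mask_sum_step (q : R) c (S0 S1 : seq nat -> R) : c != [::] -> ~~ odd (size c) ->
  eo q c S1 = oe q c S0 ->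
  mask_sum (size c) (fun A B => eoP c A B && (1 <= card_mask A + card_mask B)%N)
    (fun A B => - (mterm q c S1 A B - mterm q c S0 A B)) +
  (mask_sum (size c) (fun A B => eoP c A B && (2 <= card_mask A + card_mask B)%N)
    (fun A B => - mterm q c S0 A B) +
  mask_sum (size c) (fun A B => oeP c A B && (2 <= card_mask A + card_mask B)%N)
    (mterm q c S0)) = S1 c - S0 c.
Proof.
move=> c0 sc E.
have lin n P (F G : seq bool -> seq bool -> R) :
    mask_sum n P (fun A B => - (F A B - G A B)) = mask_sum n P G - mask_sum n P F.
  have := mask_sum_affine n P (-1) G F; rewrite mulN1r => <-.
  by apply: eq_mask_sum => // A B _; ring.
have linN n P (F : seq bool -> seq bool -> R) :
    mask_sum n P (fun A B => - F A B) = - mask_sum n P F.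
  have := lin n P F (fun _ _ => 0); rewrite {2}/mask_sum.
  rewrite big1 ?sub0r => [<-|? _]; last by rewrite big1.
  by apply: eq_mask_sum => // A B _; ring.
rewrite lin linN.
have e1 := mask_sum_eo q S1 c0 sc; have e0 := mask_sum_eo q S0 c0 sc.
have o0 := mask_sum_oe q c S0.
rewrite mask_sum_split ?eoP0 // mterm0 in e1.
rewrite mask_sum_split ?eoP0 // mterm0 mask_sum_split1 in e0.
rewrite mask_sum_split ?oeP0 // mterm0 mask_sum_split1 in o0.
have e11 : mask_sum (size c) (fun A B => oeP c A B && (card_mask A + card_mask B == 1)%N)
    (mterm q c S0) =
  mask_sum (size c) (fun A B => eoP c A B && (card_mask A + card_mask B == 1)%N)
    (mterm q c S0).
  apply: eq_mask_sum_size => // A B sA sB.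
  by case: eqP; rewrite ?andbF // => h; rewrite oeP_eoP_card1.
rewrite e11 -E -e1 in o0; rewrite mask_sum_split1.
set X := mask_sum _ _ (mterm q c S1) in o0 *.
have -> : S1 c - S0 c = S1 c + X - S0 c - X by ring.
by rewrite -o0; ring.
Qed.

End MaskSplit.

(** * Truncated zeta values of words *)

Section Discr.
Variable R : numFieldType.

(** The cutoff matches [yw], which vanishes above n because truncated subtraction gives 0 and the
    inverse of 0 is 0. Thus x_j y_j = (x_j + y_j) / (n + 1) holds for every j >= 1. *)
Definition xw (n j : nat) : R := if (j <= n)%N then j%:R^-1 else 0.
Definition yw (n j : nat) : R := (n.+1 - j)%:R^-1.
Definition discr (n : nat) (c : seq nat) : R := chain (xw n) (yw n) c (fun=> 1) n.

Lemma discr_step n c : c != [::] -> all (fun k => 0 < k)%N c -> ~~ odd (size c) ->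
  eo n.+1%:R^-1 c (discr n.+1) = oe n.+1%:R^-1 c (discr n).
Proof.
move=> c0 c_gt0 sc; apply: eo_chain => //.
- move=> j; rewrite /xw /yw; case: (leqP j.+1 n) => jn.
    have jE : n.+1%:R = (n.+1 - j.+1)%:R + j.+1%:R :> R by rewrite -natrD subnK // ltnW.
    have a0 : (n.+1 - j.+1)%:R != 0 :> R by rewrite pnatr_eq0 subn_eq0 -ltnNge ltnS.
    have b0 : j.+1%:R != 0 :> R by rewrite pnatr_eq0.
    have : n.+1%:R != 0 :> R by rewrite pnatr_eq0.
    by rewrite jE => s0; field; rewrite nat1r s0 a0 b0.
  have -> : (n.+1 - j.+1 = 0)%N by lia.
  by rewrite invr0; ring.
- by move=> j /andP[_ jn]; rewrite /xw jn (leq_trans jn).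
- by rewrite /xw leqnn.
- move=> j nj; rewrite /yw; have -> : (n.+1 - j = 0)%N by lia.
  by rewrite invr0. 
Qed.

Lemma chain0 (x y : nat -> R) c h : c != [::] -> chain x y c h 0%N = 0.
Proof.
elim/list2_ind: c h => [|a|a b c IH] h // _ /=.
  by rewrite /sblk; case: a.-1 => [|i]; rewrite /= ?ssum0 ?wsum0.
case: c IH => [|k c] IH; last by rewrite IH.
by rewrite /= /pair_blk /wblk; case: b.-1 => [|i]; rewrite /= ?wsum0.
Qed.

Lemma discr0 c : c != [::] -> discr 0 c = 0.
Proof. exact: chain0. Qed.
End Discr.

(** * Appending letters to a word and the increments of its truncation *)

Section Words.

Lemma word_index_shape w : exists rest k, [/\ (0 < k)%N,
  word_index (true :: w) = rest ++ [:: k],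
  forall m, word_index ((true :: w) ++ x_pow m) = rest ++ [:: (k + m)%N] &
  forall m, word_index ((true :: w) ++ yx_pow m) = rest ++ [:: k; m.+1]].
Proof.
pose step (b : bool) (st : nat * seq nat) :=
  if b then (0%N, (st.1).+1 :: st.2) else ((st.1).+1, st.2).
have xE m l a : foldr step (a, l) (nseq m false) = ((m + a)%N, l).
  by elim: m => //= m ->.
(* The fold runs from the right: either [w] contains a y, and its last y absorbs the incoming count
   [a] into the entry [k + a], or [w] consists of x only and just adds its length. *)
have : (exists i rest k, (0 < k)%N /\
     forall a l, foldr step (a, l) w = (i, rest ++ (k + a)%N :: l)) \/
    forall a l, foldr step (a, l) w = ((size w + a)%N, l).
  elim: w => [|b w [[i [rest [k [k0 IH]]]]|IH]]; first by right.
  - left; case: b; first by exists 0%N, (i.+1 :: rest), k; split=> // a l /=; rewrite IH.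
    by exists i.+1, rest, k; split=> // a l /=; rewrite IH.
  - case: b; last by right=> a l /=; rewrite IH.
    by left; exists 0%N, [::], (size w).+1; split=> // a l /=; rewrite IH.
have main rest k : (0 < k)%N ->
    (forall a l, foldr step (a, l) (true :: w) = (0%N, rest ++ (k + a)%N :: l)) ->
  exists rest k, [/\ (0 < k)%N,
  word_index (true :: w) = rest ++ [:: k],
  forall m, word_index ((true :: w) ++ x_pow m) = rest ++ [:: (k + m)%N] &
  forall m, word_index ((true :: w) ++ yx_pow m) = rest ++ [:: k; m.+1]].
  move=> k0 E; exists rest, k; split=> // [|m|m].
  - by rewrite /word_index -/step E addn0.
  - by rewrite /word_index -/step foldr_cat xE E addn0.
  - by rewrite /word_index -/step foldr_cat [foldr _ _ (yx_pow m)]/= xE E !addn0.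
case=> [[i [rest [k [k0 E]]]]|E].
  by apply: (main (i.+1 :: rest) k) => // a l /=; rewrite E.
by apply: (main [::] (size w).+1) => // a l /=; rewrite E.
Qed.

Lemma word_index_yx_pow m : word_index (yx_pow m) = [:: m.+1].
Proof.
rewrite /word_index /=; suff -> : forall l,
  foldr (fun b st => if b then (0%N, (st.1).+1 :: st.2) else ((st.1).+1, st.2))
    (0%N, l) (nseq m false) = (m, l) by [].
by move=> l; elim: m => //= m ->.
Qed.

Lemma last_nseq (T : Type) (b a : T) m : last b (nseq m a) = if m is 0 then b else a.
Proof. by elim: m b => //= m IH b; rewrite IH; case: m {IH}. Qed.

(** The nonempty words of the space with all exponents at least 2. *)
Definition good (w : seq bool) :=
  [&& head false w, ~~ last true w & all (fun k => 1 < k)%N (word_index w)].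

Lemma good_x_pow w m : good w -> (0 < m)%N -> good (w ++ x_pow m).
Proof.
case: w => [|[] w] // /and3P[_ _]; have [r [k [k0 E1 E2 _]]] := word_index_shape w.
case: m => // m; rewrite /good E1 E2 !all_cat /= => /and3P[-> k1 _] _.
rewrite last_cat /= last_nseq /=. by case: (m) => [|?] /=; lia.
Qed.

Lemma good_yx_pow w m : (w == [::]) || good w -> (0 < m)%N -> good (w ++ yx_pow m).
Proof.
case: m => // m; case: w => [_ _|[] w] //.
  by rewrite /good word_index_yx_pow /= last_nseq; case: (m).
move=> /and3P[_ _]; have [r [k [k0 E1 _ E2]]] := word_index_shape w.
by rewrite /good E1 E2 !all_cat /= last_cat /= last_nseq /= => /and3P[-> -> _]; case: (m).
Qed.

Variable R : realType.
Definition trunc (N : nat) (w : seq bool) : R := mzv_partial R (word_index w) N.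

Lemma hpartS k r n : hpart R (k :: r) n.+2 =
  hpart R (k :: r) n.+1 + n.+1%:R ^- k * hpart R r n.+1.
Proof. by rewrite /= big_nat_recr. Qed.

(** In the increment the largest index is n + 1, so raising the last exponent by m only contributes
    a factor. *)
Lemma trunc_x_pow w m n : head false w ->
  trunc n.+1 (w ++ x_pow m) - trunc n (w ++ x_pow m) =
  n.+1%:R^-1 ^+ m * (trunc n.+1 w - trunc n w).
Proof.
case: w => [|[] w] // _; have [r [k [k0 E1 E2 _]]] := word_index_shape w.
rewrite /trunc /mzv_partial E1 E2 !cats1 !rev_rcons !hpartS.
by rewrite -!exprVn exprD; ring.
Qed.

Lemma trunc_yx_pow w m n : (w == [::]) || head false w ->
  trunc n.+1 (w ++ yx_pow m) - trunc n (w ++ yx_pow m) =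
  n.+1%:R^-1 ^+ m.+1 * trunc n w.
Proof.
case: w => [_|[] w] //; last first.
  have [r [k [k0 E1 _ E2]]] := word_index_shape w => _.
  rewrite /trunc /mzv_partial E1 E2 -cat_rcons !cats1 !rev_rcons (hpartS m.+1).
  by rewrite -exprVn; ring.
rewrite /trunc /mzv_partial cat0s word_index_yx_pow /rev /=.
by rewrite big_nat_recr //= -exprVn; ring.
Qed.
End Words.

(** * The recursion for D on truncated sums *)

Section DWords.

Lemma DfuelS f c : c != [::] -> Dfuel f.+1 c =
  flatten [seq rmul_word (scale_nc ((-1) ^+ (card_mask AB.2).+1) (Dfuel f (reduce c AB.1 AB.2)))
                (x_pow (card_mask AB.1 + card_mask AB.2))
    | AB <- mask_pairs (size c)
    & [&& sub_ones c AB.1, even_odd (size c) AB.1, sub_gt1 c AB.2,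
          (1 <= card_mask AB.1 + card_mask AB.2)%N & noEO (size c)./2 AB.2]] ++
  flatten [seq rmul_word (scale_nc ((-1) ^+ (card_mask AB.2).+1) (Dfuel f (reduce c AB.1 AB.2)))
                (yx_pow (card_mask AB.1 + card_mask AB.2).-1)
    | AB <- mask_pairs (size c)
    & [&& sub_ones c AB.1, even_odd (size c) AB.1, sub_gt1 c AB.2,
          (2 <= card_mask AB.1 + card_mask AB.2)%N & noEO (size c)./2 AB.2]] ++
  flatten [seq rmul_word (scale_nc ((-1) ^+ (card_mask AB.2)) (Dfuel f (reduce c AB.1 AB.2)))
                (yx_pow (card_mask AB.1 + card_mask AB.2).-1)
    | AB <- mask_pairs (size c)
    & [&& sub_ones c AB.1, odd_even (size c) AB.1, sub_gt1 c AB.2,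
          (2 <= card_mask AB.1 + card_mask AB.2)%N & noOE (size c)./2 AB.2]].
Proof. by case: c. Qed.

Lemma Dfuel_nil f : Dfuel f [::] = [:: (1, [::])]. Proof. by case: f. Qed.

Definition good_poly (p : ncpoly) := all (fun t => good t.2) p.

Lemma good_poly_x_pow p a m : good_poly p -> (0 < m)%N ->
  good_poly (rmul_word (scale_nc a p) (x_pow m)).
Proof.
move=> /allP gp m0; apply/allP => _ /mapP[_ /mapP[t tp ->] ->] /=.
by apply: good_x_pow => //; apply: gp.
Qed.

Lemma good_poly_yx_pow p a m : all (fun t => (t.2 == [::]) || good t.2) p -> (0 < m)%N ->
  good_poly (rmul_word (scale_nc a p) (yx_pow m)).
Proof.
move=> /allP gp m0; apply/allP => _ /mapP[_ /mapP[t tp ->] ->] /=.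
by apply: good_yx_pow => //; apply: gp.
Qed.

Lemma good_flatten (c : seq nat) (G : seq bool * seq bool -> ncpoly)
    (P : pred (seq bool * seq bool)) :
  (forall A B, size A = size c -> size B = size c -> P (A, B) -> good_poly (G (A, B))) ->
  good_poly (flatten [seq G AB | AB <- mask_pairs (size c) & P AB]).
Proof.
move=> H; apply/allP => t /flatten_mapP[AB]; rewrite mem_filter => /andP[PAB].
case/allpairsP => -[A B] /= [/size_allmasks sA /size_allmasks sB E].
by move: PAB; rewrite E => PAB /(allP (H _ _ sA sB PAB)).
Qed.

Variable R : realType.

Lemma trunc0 w : head false w -> trunc R 0 w = 0.
Proof.
case: w => [|[] w] // _; have [r [k [k0 E _ _]]] := word_index_shape w.
by rewrite /trunc /mzv_partial E cats1 rev_rcons /= big_geq.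
Qed.

Definition trunc_poly N (p : ncpoly) : R := \sum_(t <- p) ratr t.1 * trunc R N t.2.

Lemma trunc_poly_x_pow n p a m : good_poly p ->
  trunc_poly n.+1 (rmul_word (scale_nc a p) (x_pow m)) -
  trunc_poly n (rmul_word (scale_nc a p) (x_pow m)) =
  ratr a * n.+1%:R^-1 ^+ m * (trunc_poly n.+1 p - trunc_poly n p).
Proof.
move=> /allP gp; rewrite /trunc_poly !big_map -!sumrB mulr_sumr.
apply: eq_big_seq => t /gp /and3P[ht _ _] /=.
by rewrite -mulrBr trunc_x_pow // rmorphM /=; ring.
Qed.

Lemma trunc_poly_yx_pow n p a m : all (fun t => (t.2 == [::]) || good t.2) p ->
  trunc_poly n.+1 (rmul_word (scale_nc a p) (yx_pow m)) -
  trunc_poly n (rmul_word (scale_nc a p) (yx_pow m)) =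
  ratr a * n.+1%:R^-1 ^+ m.+1 * trunc_poly n p.
Proof.
move=> /allP gp; rewrite /trunc_poly !big_map -!sumrB mulr_sumr.
apply: eq_big_seq => t /gp ht /=.
rewrite -mulrBr trunc_yx_pow ?rmorphM /=; first by ring.
by case/orP: ht => [->//|/and3P[-> _ _]]; rewrite orbT.
Qed.

Lemma trunc_poly_flatten n (c : seq nat) (G : seq bool * seq bool -> ncpoly)
    (P : pred (seq bool * seq bool)) (P' : rel (seq bool)) F :
  (forall A B, P (A, B) = P' A B) ->
  (forall A B, size A = size c -> size B = size c -> P' A B ->
    trunc_poly n.+1 (G (A, B)) - trunc_poly n (G (A, B)) = F A B) ->
  trunc_poly n.+1 (flatten [seq G AB | AB <- mask_pairs (size c) & P AB]) -
  trunc_poly n (flatten [seq G AB | AB <- mask_pairs (size c) & P AB]) =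
  mask_sum (size c) P' F.
Proof.
move=> PP' GF; rewrite /trunc_poly !big_flatten !big_map !big_filter -sumrB.
rewrite big_mkcond big_allpairs_dep /= /mask_sum.
apply: eq_big_seq => A /size_allmasks sA; rewrite [RHS]big_mkcond.
apply: eq_big_seq => B /size_allmasks sB; rewrite -PP'; case: ifP => // PAB.
by apply: GF => //; rewrite -PP'.
Qed.

(** Induction on the fuel, which bounds the weight, then on n. Goodness is proved alongside because
    the increment rule for x^m needs words starting with y. *)
Lemma Dfuel_spec f c : (sumn c <= f)%N -> all (fun k => 0 < k)%N c -> ~~ odd (size c) ->
  (forall n, trunc_poly n (Dfuel f c) = discr R n c) /\
  (c != [::] -> good_poly (Dfuel f c)).
Proof.
elim: f c => [|f IH] c cf c0 sc.
  have -> : c = [::] by case: (c) c0 cf => //= a l /andP[a0 _]; lia.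
  by split=> // n; rewrite /trunc_poly big_seq1 rmorph1 mul1r.
have [->|cn] := eqVneq c [::].
  by rewrite Dfuel_nil; split=> // n; rewrite /trunc_poly big_seq1 rmorph1 mul1r.
have red A B : size A = size c -> size B = size c -> sub_ones c A -> sub_gt1 c B ->
    ~~ odd (card_mask A) -> (0 < card_mask A + card_mask B)%N ->
    (forall n, trunc_poly n (Dfuel f (reduce c A B)) = discr R n (reduce c A B)) /\
    (reduce c A B != [::] -> good_poly (Dfuel f (reduce c A B))).
  move=> sA sB hA hB oA AB0; apply: IH.
  - by have := reduce_sumn sA sB hB hA; lia.
  - exact: reduce_gt0.
  - by move: sc; rewrite -(reduce_size sA sB) oddD (negbTE oA) addbF.
have red' A B : size A = size c -> size B = size c -> sub_ones c A -> sub_gt1 c B ->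
    ~~ odd (card_mask A) -> (0 < card_mask A + card_mask B)%N ->
    all (fun t => (t.2 == [::]) || good t.2) (Dfuel f (reduce c A B)).
  move=> sA sB hA hB oA AB0; have [_] := red A B sA sB hA hB oA AB0.
  have [->|_ /(_ isT)] := eqVneq (reduce c A B) [::]; first by rewrite Dfuel_nil.
  by apply: sub_all => t ->; rewrite orbT.
have gD : good_poly (Dfuel f.+1 c).
  rewrite DfuelS // /good_poly !all_cat; apply/and3P; split; apply: good_flatten => A B sA sB
    /and5P[hA eA hB AB1 nB].
  - apply: good_poly_x_pow => //; have [_] := red A B sA sB hA hB (even_odd_card sA eA) AB1.
    by apply; apply: reduce_neq0.
  - apply: good_poly_yx_pow; last by case: addn AB1 => [|[|]].
    by apply: red' => //; [apply: even_odd_card eA | lia].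
  - apply: good_poly_yx_pow; last by case: addn AB1 => [|[|]].
    by apply: red' => //; [apply: odd_even_card eA | lia].
have scat p1 p2 k : trunc_poly k (p1 ++ p2) = trunc_poly k p1 + trunc_poly k p2.
  by rewrite /trunc_poly big_cat.
split=> // n; elim: n => [|n IHn].
  rewrite discr0 // /trunc_poly big_seq big1 // => t /(allP gD) /and3P[h _ _].
  by rewrite trunc0 // mulr0.
(* Both sides vanish at n = 0, so it suffices to compare increments, which [mask_sum_step]
   describes. *)
apply: (addIr (- trunc_poly n (Dfuel f.+1 c))); rewrite {2}IHn.
rewrite -(mask_sum_step cn sc (discr_step R n cn c0 sc)).
rewrite DfuelS // !scat.
set t1 := flatten _; set t2 := flatten _; set t3 := flatten _.
have -> : trunc_poly n.+1 t1 + (trunc_poly n.+1 t2 + trunc_poly n.+1 t3) -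
   (trunc_poly n t1 + (trunc_poly n t2 + trunc_poly n t3)) =
   (trunc_poly n.+1 t1 - trunc_poly n t1) + ((trunc_poly n.+1 t2 - trunc_poly n t2) +
   (trunc_poly n.+1 t3 - trunc_poly n t3)) by ring.
have ratr_sign k : ratr ((-1) ^+ k) = (-1) ^+ k :> R by rewrite rmorphXn rmorphN1.
congr (_ + (_ + _)).
- apply: trunc_poly_flatten => [A B|A B sA sB].
    by rewrite /eoP /= -!andbA; do 3 congr andb; rewrite andbC.
  move=> /andP[/and4P[hA eA hB nB] AB1].
  have [E g] := red A B sA sB hA hB (even_odd_card sA eA) AB1.
  rewrite trunc_poly_x_pow ?g ?reduce_neq0 // !E ratr_sign exprS /mterm /=; ring.
- apply: trunc_poly_flatten => [A B|A B sA sB].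
    by rewrite /eoP /= -!andbA; do 3 congr andb; rewrite andbC.
  move=> /andP[/and4P[hA eA hB nB] AB2]; have AB1 := ltnW AB2.
  have oA := even_odd_card sA eA.
  have [E _] := red A B sA sB hA hB oA AB1.
  rewrite trunc_poly_yx_pow ?red' // !E ratr_sign exprS /mterm prednK //=; ring.
- apply: trunc_poly_flatten => [A B|A B sA sB].
    by rewrite /oeP /= -!andbA; do 3 congr andb; rewrite andbC.
  move=> /andP[/and4P[hA eA hB nB] AB2]; have AB1 := ltnW AB2.
  have oA := odd_even_card sA eA.
  have [E _] := red A B sA sB hA hB oA AB1.
  by rewrite trunc_poly_yx_pow ?red' // !E ratr_sign /mterm prednK.
Qed.
End DWords.

(** * Discretized iterated integrals *)

Section Connector.
Variable R : numFieldType.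
Implicit Types g h : nat -> R.

Definition conn N m k : R := 'C(m, k)%:R / 'C(N, k)%:R.
Definition xop g n := g n / n%:R.
Definition yop g n := (\sum_(0 <= l < n) g l) / n%:R.
(** The connected sum: [g] is the coefficient sequence of [h] in the connectors. At m = N every
    connector is 1, so h N is the plain sum of [g]. *)
Definition expands N h g :=
  forall m, (m <= N)%N -> h m = \sum_(0 <= k < N.+1) g k * conn N m k.

Lemma mul_binS_real m k : k.+1%:R * 'C(m, k.+1)%:R = (m%:R - k%:R) * 'C(m, k)%:R :> R.
Proof.
rewrite -natrM mul_bin_left; case: (leqP k m) => km; first by rewrite natrM natrB.
by rewrite bin_small // muln0 mulr0.
Qed.

Lemma expands1 N : expands N (fun=> 1) (fun k => (k == 0%N)%:R).
Proof.
move=> m mN; rewrite big_nat_recl // big1 => [|k _]; last by rewrite mul0r.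
by rewrite /conn !bin0 divr1 mulr1 addr0.
Qed.

(** Induction on m from C(m+1, k) - C(m, k) = C(m, k-1) = k C(m+1, k) / (m+1). The condition
    [g 0 = 0] is there because [xop] kills the coefficient at 0. *)
Lemma expands_x N h g : g 0%N = 0 -> expands N h g ->
  expands N (wsum (xw R N) h) (xop g).
Proof.
move=> g0 hg; elim=> [|m IH] mN.
  rewrite wsum0 big1 // => -[|k] _; first by rewrite /xop g0 !mul0r.
  by rewrite /conn bin_small // mul0r mulr0.
rewrite wsumS IH ?(ltnW mN) // hg // mulr_sumr -big_split.
apply: eq_big_nat => -[|k] _ /=; first by rewrite /xop g0 !mul0r mulr0 addr0.
have E : 'C(m, k)%:R = k.+1%:R * 'C(m.+1, k.+1)%:R / m.+1%:R :> R.
  by rewrite -natrM -mul_bin_diag natrM mulrAC divff ?mul1r ?pnatr_eq0.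
have b : 'C(m, k.+1)%:R = 'C(m.+1, k.+1)%:R - 'C(m, k)%:R :> R.
  by rewrite binS natrD addrK.
rewrite /xop /conn b E /xw mN.
have k0 : k.+1%:R != 0 :> R by rewrite pnatr_eq0.
have m0 : m.+1%:R != 0 :> R by rewrite pnatr_eq0.
move: k0 m0 ('C(N, k.+1)%:R^-1); move: (k.+1%:R) (m.+1%:R) => x y k0 m0 z.
by field; rewrite k0 m0.
Qed.

(** Exchange relation for a letter y: a difference in m with weight 1/(k+1) becomes a difference in
    k with weight 1/(N-m), the value of [yw] at m + 1. *)
Lemma conn_telescope N m k : (m < N)%N -> (k < N)%N ->
  (conn N m.+1 k.+1 - conn N m k.+1) / k.+1%:R =
  (conn N m k - conn N m k.+1) / (N - m)%:R.
Proof.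
move=> mN kN.
have C0 : 'C(N, k)%:R != 0 :> R by rewrite pnatr_eq0 -lt0n bin_gt0 ltnW.
have k0 : k.+1%:R != 0 :> R by rewrite pnatr_eq0.
have Nk : (N%:R - k%:R) != 0 :> R by rewrite -natrB ?(ltnW kN)// pnatr_eq0 subn_eq0 -ltnNge.
have Nm : (N%:R - m%:R) != 0 :> R by rewrite -natrB ?(ltnW mN)// pnatr_eq0 subn_eq0 -ltnNge.
have solve M : 'C(M, k.+1)%:R = (M%:R - k%:R) * 'C(M, k)%:R / k.+1%:R :> R.
  by rewrite -mul_binS_real mulrAC divff ?mul1r.
rewrite /conn binS natrD !solve natrB ?(ltnW mN) //.
move: C0 k0 Nk Nm ('C(m, k)%:R) => C0 k0 Nk Nm b.
move: k0; move: (k.+1%:R) => x k0.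
by field; rewrite C0 k0 Nk Nm.
Qed.

(* Abel summation. *)
Lemma expands_y N h g : expands N h g -> expands N (ssum (yw R N) h) (yop g).
Proof.
move=> hg; elim=> [|m IH] mN.
  rewrite ssum0 big1 // => -[|k] _; first by rewrite /yop invr0 !mulr0 mul0r.
  by rewrite /conn bin_small // mul0r mulr0.
rewrite ssumS IH ?(ltnW mN) // hg ?(ltnW mN) //; apply/eqP; rewrite eq_sym -subr_eq0 opprD.
rewrite addrA -sumrB subr_eq0; apply/eqP; rewrite /yw subSS.
pose r l := conn N m l / (N - m)%:R.
have abel K : (K <= N)%N -> \sum_(0 <= k < K.+1) (yop g k * conn N m.+1 k - yop g k * conn N m k) =
    \sum_(0 <= l < K) g l * r l - (\sum_(0 <= l < K) g l) * r K.
  elim: K => [|K IHK] KN.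
    by rewrite big_nat1 !big_geq // /yop big_geq // !mul0r.
  rewrite big_nat_recr //= IHK ?(ltnW KN) // -mulrBr.
  have -> : yop g K.+1 * (conn N m.+1 K.+1 - conn N m K.+1) =
      (\sum_(0 <= l < K.+1) g l) * (r K - r K.+1).
    by rewrite /yop mulrAC -mulrA conn_telescope // /r -mulrBl.
  by rewrite !big_nat_recr //=; ring.
have cN : conn N m N = 0 by rewrite /conn bin_small // mul0r.
rewrite abel // {2}/r cN mul0r mulr0 subr0.
rewrite [in RHS]big_nat_recr //= cN mulr0 addr0 mulr_sumr.
by apply: eq_big_nat => k _; rewrite /r; ring.
Qed.

Fixpoint mchain (x y : nat -> R) (c : seq nat) h : nat -> R :=
  match c with
  | a :: b :: c' => mchain x y c' (wblk x b (iter a.-1 (ssum y) (ssum y h)))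
  | _ => h
  end.

Fixpoint gchain (c : seq nat) g : nat -> R :=
  match c with
  | a :: b :: c' => gchain c' (iter b.-1 xop (xop (iter a.-1 yop (yop g))))
  | _ => g
  end.

Lemma expands_mchain N c h g : expands N h g ->
  expands N (mchain (xw R N) (yw R N) c h) (gchain c g).
Proof.
elim/list2_ind: c h g => [|a|a b c IH] h g hg //=; apply: IH.
have hy : expands N (iter a.-1 (ssum (yw R N)) (ssum (yw R N) h)) (iter a.-1 yop (yop g)).
  by elim: a.-1 => [|i IHi] /=; apply: expands_y.
have y0 i : iter i yop (yop g) 0%N = 0 by case: i => [|i]; rewrite /= /yop invr0 mulr0.
rewrite /wblk; elim: b.-1 => [|i IHi] /=; apply: expands_x => //.
by case: i {IHi} => [|i]; rewrite /= /xop invr0 mulr0.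
Qed.

(** A version of [hpart] with arbitrary innermost value, so that concatenated indices compose. *)
Fixpoint hsum (G : nat -> R) (r : seq nat) n : R :=
  if r is k :: r' then \sum_(1 <= i < n) i%:R ^- k * hsum G r' i else G n.

Lemma hsum_cat G r1 r2 n : hsum G (r1 ++ r2) n = hsum (hsum G r2) r1 n.
Proof. by elim: r1 n => //= k r1 IH n; apply: eq_big_nat => i _; rewrite IH. Qed.

Definition cumul g n := \sum_(0 <= j < n) g j.

Lemma cumul_div g b n : cumul (fun n => cumul g n / n%:R ^+ b.+1) n = hsum (cumul g) [:: b.+1] n.
Proof.
case: n => [|n]; first by rewrite /cumul /= !big_geq.
rewrite {1}/cumul big_ltn //=.
have -> : cumul g 0%N = 0 by rewrite /cumul big_geq.
rewrite mul0r add0r.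
by apply: eq_big_nat => i _; rewrite mulrC.
Qed.

Lemma cumul_yop g : cumul (yop g) = hsum (cumul g) [:: 1%N].
Proof. by apply/funext => n; rewrite -cumul_div. Qed.

Lemma cumul_iter_yop i g : cumul (iter i yop g) = hsum (cumul g) (nseq i 1%N).
Proof.
elim: i => [//|i IH]; rewrite iterS cumul_yop IH; apply/funext => n.
by rewrite -[nseq i.+1 _]/([:: 1%N] ++ _) hsum_cat.
Qed.

(** Each of the first a - 1 letters y gives an entry 1; the division by n in the last y joins those
    of the b letters x to give the exponent b + 1. *)
Lemma cumul_block a b g : (0 < a)%N -> (0 < b)%N ->
  cumul (iter b.-1 xop (xop (iter a.-1 yop (yop g)))) =
  hsum (cumul g) (b.+1 :: nseq a.-1 1%N).
Proof.
case: b => // b; case: a => // a _ _; rewrite [a.+1.-1]/= [b.+1.-1]/= -(iterSr _ xop) -(iterSr _ yop) (iterS _ yop).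
have -> : iter b.+1 xop (yop (iter a yop g)) =
    fun n => cumul (iter a yop g) n / n%:R ^+ b.+2.
  apply/funext => n; elim: (b.+1) => [|i IH]; first by rewrite /= expr1.
  by rewrite iterS /xop IH [in RHS]exprSr invfM mulrA.
apply/funext => n; rewrite cumul_div cumul_iter_yop.
by rewrite -[_ :: nseq _ _]/([:: b.+2] ++ _) hsum_cat.
Qed.

Lemma cumul_gchain c g : all (fun k => 0 < k)%N c -> ~~ odd (size c) ->
  cumul (gchain c g) = hsum (cumul g) (rev (lhs_index c)).
Proof.
elim/list2_ind: c g => [|a|a b c IH] g //= /and3P[a0 b0 c0].
rewrite negbK => sc; rewrite IH // cumul_block // rev_cat rev_cons.
have -> : rev (nseq a.-1 1%N) = nseq a.-1 1%N by rewrite rev_nseq.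
by apply/funext => n; rewrite cat_rcons hsum_cat.
Qed.
End Connector.

Lemma hpart_hsum (R : realType) r n :
  hpart R r n.+1 = hsum (cumul (fun k => (k == 0%N)%:R)) r n.+1.
Proof.
elim: r n => [|k r IH] n /=.
  by rewrite /cumul big_ltn // big1_seq ?addr0 // => i; rewrite mem_index_iota; case: i.
by apply: eq_big_nat => -[|i] // _; rewrite IH.
Qed.

(** An exact identity at each finite level: expand at m = N, where all connectors equal 1. *)
Lemma mzv_partial_mchain (R : realType) N c :
  all (fun k => 0 < k)%N c -> ~~ odd (size c) ->
  mzv_partial R (lhs_index c) N = mchain (xw R N) (yw R N) c (fun=> 1) N.
Proof.
move=> c0 sc; rewrite (expands_mchain c (@expands1 R N)) //.
rewrite /mzv_partial hpart_hsum -cumul_gchain //; apply: eq_big_nat => k /andP[_ kN].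
by rewrite /conn divff ?mulr1 // pnatr_eq0 -lt0n bin_gt0.
Qed.

(** * Comparison of the two discretizations *)

Section ErrorBound.
Variables (R : realFieldType) (N : nat).
Hypothesis N0 : (0 < N)%N.
Implicit Types (w s t : nat -> R).

Let H : R := \sum_(0 <= j < N) j.+1%:R^-1.

Lemma harm_ge1 : 1 <= H.
Proof.
rewrite /H big_ltn // invr1 lerDl; apply: sumr_ge0 => j _.
by rewrite invr_ge0 ler0n.
Qed.
Let H_ge0 : 0 <= H := le_trans ler01 harm_ge1.

Lemma xw_ge0 j : 0 <= xw R N j.
Proof. by rewrite /xw; case: ifP => // _; rewrite invr_ge0 ler0n. Qed.
Lemma yw_ge0 j : 0 <= yw R N j.
Proof. by rewrite /yw invr_ge0 ler0n. Qed.

Lemma sum_xw : \sum_(1 <= j < N.+1) xw R N j = H.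
Proof.
by rewrite big_add1; apply: eq_big_nat => j /andP[_ jN]; rewrite /xw jN.
Qed.

Lemma sum_yw : \sum_(1 <= j < N.+1) yw R N j = H.
Proof.
rewrite -sum_xw [RHS]big_nat_rev; apply: eq_big_nat => j /andP[j0 jN].
by rewrite /xw /yw add1n subSS; case: ifP => //; lia.
Qed.

Lemma weighted_bound w f m B : (m <= N)%N -> (forall j, 0 <= w j) ->
  \sum_(1 <= j < N.+1) w j = H -> 0 <= B ->
  (forall j, (0 < j <= m)%N -> `|f j| <= B) ->
  `|\sum_(1 <= j < m.+1) w j * f j| <= H * B.
Proof.
move=> mN w0 wH B0 fB; apply: (le_trans (ler_norm_sum _ _ _)).
have -> : H = \sum_(1 <= j < m.+1) w j + \sum_(m.+1 <= j < N.+1) w j.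
  by rewrite -wH (@big_cat_nat _ _ _ m.+1).
rewrite mulrDl -[leLHS]addr0; apply: lerD; last first.
  by rewrite mulr_ge0 // sumr_ge0.
rewrite mulr_suml; apply: ler_sum_nat => j /andP[j0 jm].
by rewrite normrM ger0_norm // ler_wpM2l // fB // j0.
Qed.

(* The weight yw N m = 1 / (N + 1 - m) on the right is what survives both kinds of letters;
   it only becomes O(H / N) after summation against a final x. *)
Definition close p s t := forall m, (m <= N)%N ->
  `|s m| <= H ^+ p /\ `|s m - t m| <= p%:R * H ^+ p * yw R N m.

(** Control of one-step increments, needed where a weak inequality is replaced by a strict one. *)
Definition slow p s := forall m, (m < N)%N -> `|s m.+1 - s m| <= H ^+ p * yw R N m.+1.

Lemma yw_le m j : (j <= m)%N -> (m <= N)%N -> yw R N j <= yw R N m.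
Proof.
move=> jm mN; rewrite /yw lef_pV2 ?posrE ?ltr0n ?subn_gt0 ?ltnS ?ler_nat //; last lia.
exact: leq_sub2l.
Qed.

Lemma H_exp_ge0 p : 0 <= H ^+ p. Proof. exact: exprn_ge0. Qed.

Lemma bound_step p m : p%:R * H ^+ p * yw R N m * H <= p.+1%:R * H ^+ p.+1 * yw R N m.
Proof.
have -> : p%:R * H ^+ p * yw R N m * H = p%:R * H ^+ p.+1 * yw R N m by rewrite exprS; ring.
by rewrite ler_wpM2r ?yw_ge0 // ler_wpM2r ?H_exp_ge0 // ler_nat.
Qed.

Lemma wsumB w s t m : wsum w s m - wsum w t m =
  \sum_(1 <= j < m.+1) w j * (s j - t j).
Proof. by rewrite /wsum -sumrB; apply: eq_bigr => j _; rewrite mulrBr. Qed.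

Lemma close_wsum_x p s t : close p s t -> close p.+1 (wsum (xw R N) s) (wsum (xw R N) t).
Proof.
move=> st m mN; split.
  rewrite exprS; apply: weighted_bound => //.
  - exact: xw_ge0.
  - exact: sum_xw.
  - exact: H_exp_ge0.
  - by move=> j /andP[_ jm]; have [] := st j (leq_trans jm mN).
rewrite wsumB; apply: le_trans (bound_step p m); rewrite [leRHS]mulrC.
apply: weighted_bound => //.
- exact: xw_ge0.
- exact: sum_xw.
- by rewrite !mulr_ge0 ?yw_ge0 ?H_exp_ge0.
- move=> j /andP[_ jm]; have [_ h] := st j (leq_trans jm mN).
  by apply: le_trans h _; rewrite ler_wpM2l ?yw_le // mulr_ge0 ?H_exp_ge0.
Qed.

Lemma close_ssum_y p s t : close p s t ->
  close p.+1 (ssum (yw R N) s) (ssum (yw R N) t) /\ slow p.+1 (ssum (yw R N) s).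
Proof.
move=> st; split; last first.
  move=> m mN; rewrite ssumS addrC addKr normrM ger0_norm ?yw_ge0 // mulrC.
  rewrite ler_wpM2r ?yw_ge0 //; have [h _] := st m (ltnW mN); apply: le_trans h _.
  by rewrite ler_weXn2l ?harm_ge1.
move=> m mN; split.
  rewrite exprS; apply: weighted_bound => //.
  - exact: yw_ge0.
  - exact: sum_yw.
  - exact: H_exp_ge0.
  - by case=> // j /andP[_ jm] /=; have [] := st j (leq_trans (ltnW jm) mN).
have -> : ssum (yw R N) s m - ssum (yw R N) t m =
    \sum_(1 <= j < m.+1) yw R N j * (s j.-1 - t j.-1).
  by rewrite /ssum -sumrB; apply: eq_bigr => j _; rewrite mulrBr.
apply: le_trans (bound_step p m); rewrite [leRHS]mulrC.
apply: weighted_bound => //.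
- exact: yw_ge0.
- exact: sum_yw.
- by rewrite !mulr_ge0 ?yw_ge0 ?H_exp_ge0.
- case=> // j /andP[_ jm] /=; have [_ h] := st j (leq_trans (ltnW jm) mN).
  by apply: le_trans h _; rewrite ler_wpM2l ?yw_le ?(ltnW jm) // mulr_ge0 ?H_exp_ge0.
Qed.

Lemma close_wsum_ssum_y p s t : close p s t -> slow p s ->
  close p.+1 (wsum (yw R N) s) (ssum (yw R N) t) /\ slow p.+1 (wsum (yw R N) s).
Proof.
move=> st sl; split; last first.
  move=> m mN; rewrite wsumS addrC addKr normrM ger0_norm ?yw_ge0 // mulrC.
  rewrite ler_wpM2r ?yw_ge0 //; have [h _] := st m.+1 mN; apply: le_trans h _.
  by rewrite ler_weXn2l ?harm_ge1.
move=> m mN; split.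
  rewrite exprS; apply: weighted_bound => //.
  - exact: yw_ge0.
  - exact: sum_yw.
  - exact: H_exp_ge0.
  - by move=> j /andP[_ jm]; have [] := st j (leq_trans jm mN).
have -> : wsum (yw R N) s m - ssum (yw R N) t m =
    \sum_(1 <= j < m.+1) yw R N j * (s j - t j.-1).
  by rewrite /ssum /wsum -sumrB; apply: eq_bigr => j _; rewrite mulrBr.
have -> : p.+1%:R * H ^+ p.+1 * yw R N m = H * (p.+1%:R * H ^+ p * yw R N m).
  by rewrite exprS; ring.
apply: weighted_bound => //.
- exact: yw_ge0.
- exact: sum_yw.
- by rewrite !mulr_ge0 ?yw_ge0 ?H_exp_ge0.
- case=> // j /andP[_ jm] /=; have jN := leq_trans jm mN.
  have [_ h] := st j (ltnW jN); have h' := sl j jN.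
  (* Slowness bounds the first part and closeness the second; together they give the coefficient p +
     1. *)
  have -> : s j.+1 - t j = (s j.+1 - s j) + (s j - t j) by ring.
  apply: le_trans (ler_normD _ _) _; rewrite -natr1 mulrDl mul1r mulrDl addrC.
  apply: lerD.
    by apply: le_trans h _; rewrite ler_wpM2l ?yw_le ?(ltnW jm) // mulr_ge0 ?H_exp_ge0.
  by apply: le_trans h' _; rewrite ler_wpM2l ?yw_le ?H_exp_ge0.
Qed.

Lemma close_block p a s t : (0 < a)%N -> close p s t ->
  close (p + a) (sblk (yw R N) a s) (iter a.-1 (ssum (yw R N)) (ssum (yw R N) t)).
Proof.
case: a => // a _ st; rewrite /sblk addnS [a.+1.-1]/=.
suff [] : close (p + a).+1 (iter a (wsum (yw R N)) (ssum (yw R N) s))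
   (iter a (ssum (yw R N)) (ssum (yw R N) t)) /\
  slow (p + a).+1 (iter a (wsum (yw R N)) (ssum (yw R N) s)) by [].
elim: a => [|a [IH1 IH2]]; first by rewrite addn0; apply: close_ssum_y.
by rewrite addnS; apply: close_wsum_ssum_y.
Qed.

Lemma close_wblk p b s t : (0 < b)%N -> close p s t ->
  close (p + b) (wblk (xw R N) b s) (wblk (xw R N) b t).
Proof.
case: b => // b _ st; rewrite !wblk_iter.
elim: b.+1 => [|i IH]; first by rewrite addn0.
by rewrite addnS; apply: close_wsum_x.
Qed.

(** Against a final x the error weight turns into x_j y_j = (x_j + y_j) / (N + 1), whose sum over j
    is 2 H / (N + 1). *)
Lemma final_wsum p s t : close p s t ->
  `|wsum (xw R N) s N - wsum (xw R N) t N| <= (p.+1%:R * H ^+ p.+1 * 2) / N.+1%:R.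
Proof.
move=> st; rewrite wsumB; apply: le_trans (ler_norm_sum _ _ _) _.
have xy j : (0 < j <= N)%N ->
    xw R N j * yw R N j = (xw R N j + yw R N j) / N.+1%:R.
  move=> /andP[j0 jN]; rewrite /xw /yw jN.
  have nE : N.+1%:R = (N.+1 - j)%:R + j%:R :> R by rewrite -natrD subnK // ltnW.
  have a0 : (N.+1 - j)%:R != 0 :> R by rewrite pnatr_eq0 subn_eq0 -ltnNge ltnS.
  have b0 : j%:R != 0 :> R by rewrite pnatr_eq0 -lt0n.
  have : N.+1%:R != 0 :> R by rewrite pnatr_eq0.
  by rewrite nE => s0; field; rewrite s0 a0 b0.
apply: (@le_trans _ _ (\sum_(1 <= j < N.+1)
    (p%:R * H ^+ p) * ((xw R N j + yw R N j) / N.+1%:R))).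
  apply: ler_sum_nat => j /andP[j0 jN]; rewrite -xy ?j0 //.
  rewrite normrM ger0_norm ?xw_ge0 // mulrCA ler_wpM2l ?xw_ge0 //.
  by have [] := st j jN.
rewrite -mulr_sumr -mulr_suml big_split /= sum_xw sum_yw -[H + H]mulr2n.
rewrite mulrA ler_wpM2r ?invr_ge0 ?ler0n // mulr_natr mulrnAr lerMn2r /=.
by rewrite -mulrA -exprSr ler_wpM2r ?H_exp_ge0 // ler_nat.
Qed.

Lemma chain_error p c s t : c != [::] -> all (fun k => 0 < k)%N c -> ~~ odd (size c) ->
  close p s t ->
  `|chain (xw R N) (yw R N) c s N - mchain (xw R N) (yw R N) c t N| <=
  ((p + sumn c)%:R * H ^+ (p + sumn c) * 2) / N.+1%:R.
Proof.
elim/list2_ind: c p s t => [|a|a b c IH] p s t //= _ /and3P[a0 b0 c0].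
rewrite negbK => sc st; have st1 := close_block a0 st.
have [c_nil|cn] := eqVneq c [::]; last first.
  have := IH (p + a + b)%N _ _ cn c0 sc (close_wblk b0 st1).
  by rewrite -!addnA; apply.
rewrite c_nil /= addn0 /pair_blk; case: b b0 => // b _.
(* The last x is kept for [final_wsum]; the b letters before it only propagate closeness. *)
have := final_wsum (s := iter b (wsum (xw R N)) (sblk (yw R N) a s)).
rewrite /wblk [b.+1.-1]/= -!(iterSr _ (wsum (xw R N))) !(iterS _ (wsum (xw R N))) addnA addnS; apply.
elim: b => [|i IHi]; first by rewrite addn0.
by rewrite addnS; apply: close_wsum_x.
Qed.

Lemma discr_error c : c != [::] -> all (fun k => 0 < k)%N c -> ~~ odd (size c) ->
  `|discr R N c - mchain (xw R N) (yw R N) c (fun=> 1) N| <=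
  ((sumn c)%:R * H ^+ (sumn c) * 2) / N.+1%:R.
Proof.
move=> cn c0 sc; apply: (chain_error (p := 0)) => // m mN.
by rewrite expr0 normr1 lexx subrr normr0 !mul0r.
Qed.
End ErrorBound.

(** * Limits *)

Local Open Scope classical_set_scope.

Section Limits.
Variable R : realType.

Lemma exprB_le (a b : R) K : 0 <= a -> a <= b ->
  b ^+ K.+1 - a ^+ K.+1 <= K.+1%:R * ((b - a) * b ^+ K).
Proof.
move=> a0 ab; have b0 := le_trans a0 ab; elim: K => [|K IH].
  by rewrite !expr1 expr0 mulr1 mulr1n mul1r.
have -> : b ^+ K.+2 - a ^+ K.+2 = b * (b ^+ K.+1 - a ^+ K.+1) + (b - a) * a ^+ K.+1.
  by rewrite !(exprS _ K.+1); ring.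
rewrite -[K.+2%:R]natr1 [leRHS]mulrDl mul1r; apply: lerD.
  have -> : K.+1%:R * ((b - a) * b ^+ K.+1) = b * (K.+1%:R * ((b - a) * b ^+ K)).
    by rewrite exprS; ring.
  by rewrite ler_wpM2l.
by rewrite ler_wpM2l ?subr_ge0 // lerXn2r ?nnegrE.
Qed.

(** Induction on K by Cesaro: the quotient for K + 1 is the mean of the increments of the (K+1)-st
    powers, which are at most (K + 1) times the quotient for K. *)
Lemma harmonic_pow_cvg K :
  (fun n => series (@harmonic R) n.+1 ^+ K / n.+1%:R) @ \oo --> (0 : R).
Proof.
elim: K => [|K IH].
  have -> : (fun n => series (@harmonic R) n.+1 ^+ 0 / n.+1%:R) = @harmonic R.
    by apply/funext => n; rewrite expr0 mul1r.
  exact: cvg_harmonic.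
pose h n := series (@harmonic R) n.
have h0 n : 0 <= h n by apply: sumr_ge0 => i _; rewrite invr_ge0 ler0n.
have hS n : h n.+1 = h n + n.+1%:R^-1 by rewrite /h seriesEnat /= big_nat_recr.
pose u n := h n.+1 ^+ K.+1 - h n ^+ K.+1.
have u_cvg : u @ \oo --> (0 : R).
  apply: (@squeeze_cvgr _ _ _ _ (fun=> 0) (fun n => K.+1%:R * (h n.+1 ^+ K / n.+1%:R))).
  - near=> n; have hn : h n <= h n.+1 by rewrite hS lerDl invr_ge0 ler0n.
    rewrite subr_ge0 lerXn2r ?nnegrE ?h0 //=.
    apply: le_trans (exprB_le _ (h0 n) hn) _; rewrite {1}hS addrAC subrr add0r.
    by rewrite [_^-1 * _]mulrC.
  - exact: cvg_cst.
  - by rewrite -[X in _ --> X](mulr0 K.+1%:R); apply: cvgMr.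
have <- : arithmetic_mean u = fun n => series (@harmonic R) n.+1 ^+ K.+1 / n.+1%:R.
  apply/funext => n; rewrite /arithmetic_mean /= mulrC; congr (_ / _).
  by rewrite seriesEnat /= telescope_sumr // /h [series _ 0%N]big_geq // expr0n subr0.
exact: cesaro.
Unshelve. all: by end_near. Qed.

Lemma hpart_ge0 r n : 0 <= hpart R r n.
Proof.
elim: r n => [|k r IH] n //=; apply: sumr_ge0 => i _.
by rewrite mulr_ge0 // invr_ge0 exprn_ge0.
Qed.

Lemma sum_inv_pow_le k n : (1 < k)%N -> \sum_(1 <= i < n.+2) i%:R ^- k <= 2 - n.+1%:R^-1 :> R.
Proof.
move=> k1; elim: n => [|n IH].
  by rewrite big_nat1 expr1n invr1; lra.
rewrite big_nat_recr //=; apply: le_trans (lerD IH (lexx _)) _.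
have n0 : n.+1%:R != 0 :> R by rewrite pnatr_eq0.
have n1 : n.+2%:R != 0 :> R by rewrite pnatr_eq0.
have le2 : n.+2%:R ^- k <= n.+2%:R ^- 2 :> R.
  by rewrite lef_pV2 ?posrE ?exprn_gt0 // ler_weXn2l // ler1n.
have : n.+2%:R ^- 2 <= n.+1%:R^-1 - n.+2%:R^-1 :> R.
  have -> : n.+1%:R^-1 - n.+2%:R^-1 = (n.+1%:R * n.+2%:R)^-1 :> R.
    have E : n.+2%:R = n.+1%:R + 1 :> R by rewrite natr1.
    by move: n1; rewrite E; move: (n.+1%:R) n0 => z z0 z1; field; rewrite z0 z1.
  by rewrite lef_pV2 ?posrE ?mulr_gt0 ?exprn_gt0 // expr2 ler_wpM2r // ler_nat.
move=> /(le_trans le2); move: (n.+1%:R^-1) (n.+2%:R^-1) (n.+2%:R ^- k) => a b x h; lra.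
Qed.

(** With all exponents at least 2, each nested sum contributes at most a factor 2, by the
    telescoping bound [sum_inv_pow_le]. *)
Lemma hpart_le r n : all (fun k => 1 < k)%N r -> hpart R r n <= 2 ^+ size r.
Proof.
elim: r n => [|k r IH] n //= /andP[k1 r1].
apply: (@le_trans _ _ (\sum_(1 <= i < n) i%:R ^- k * 2 ^+ size r)).
  by apply: ler_sum_nat => i _; rewrite ler_wpM2l ?IH // invr_ge0 exprn_ge0.
rewrite -mulr_suml exprS ler_wpM2r ?exprn_ge0 //.
case: n => [|[|n]]; [by rewrite big_geq | by rewrite big_geq |].
by apply: le_trans (sum_inv_pow_le n k1) _; rewrite gerBl invr_ge0.
Qed.

Lemma mzv_partial_nondecreasing ks : nondecreasing_seq (mzv_partial R ks).
Proof.
apply/nondecreasing_seqP => n; rewrite /mzv_partial; case: (rev ks) => [|k r] //.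
by rewrite hpartS lerDl mulr_ge0 ?hpart_ge0 // invr_ge0 exprn_ge0.
Qed.

Lemma mzv_partial_cvg ks : all (fun k => 1 < k)%N ks -> mzv_partial R ks @ \oo --> mzv R ks.
Proof.
move=> k1; have : cvgn (mzv_partial R ks).
  apply: nondecreasing_is_cvgn; first exact: mzv_partial_nondecreasing.
  exists (2 ^+ size (rev ks)) => _ [n _ <-]; apply: hpart_le.
  by rewrite all_rev.
by [].
Qed.

Lemma trunc_cvg w : good w -> (fun n => trunc R n w) @ \oo --> Zword R w.
Proof.
move=> /and3P[hw lw aw]; rewrite (_ : Zword R w = mzv R (word_index w)); last first.
  by case: w hw lw aw => // b w /= -> /negbTE ->.
exact: mzv_partial_cvg.
Qed.

Lemma trunc_poly_cvg p : good_poly p -> (fun n => trunc_poly R n p) @ \oo --> Zlin R p.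
Proof.
rewrite /Zlin /trunc_poly; elim: p => [_|t p IH /andP[gt gp]].
  have -> : (fun n => \sum_(t <- [::]) ratr t.1 * trunc R n t.2) = fun=> 0.
    by apply/funext => n; rewrite big_nil.
  by rewrite big_nil; apply: cvg_cst.
have -> : (fun n => \sum_(t <- t :: p) ratr t.1 * trunc R n t.2) =
    fun n => ratr t.1 * trunc R n t.2 + \sum_(t <- p) ratr t.1 * trunc R n t.2.
  by apply/funext => n; rewrite big_cons.
rewrite big_cons; apply: cvgD; last exact: IH.
by apply: cvgMr; exact: (trunc_cvg gt).
Qed.

Lemma mchain_cvg (c : seq nat) (l : R) : c != [::] -> all (fun k => 0 < k)%N c -> ~~ odd (size c) ->
  (fun n => discr R n c) @ \oo --> l ->
  (fun n => mchain (xw R n) (yw R n) c (fun=> 1) n) @ \oo --> l.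
Proof.
(* The error bound requires N > 0, so both sequences are shifted to N = n + 1. *)
move=> cn c0 sc; rewrite -cvg_shiftS => S_cvg; rewrite -cvg_shiftS.
pose e n := discr R n.+1 c - mchain (xw R n.+1) (yw R n.+1) c (fun=> 1) n.+1.
have e_cvg : e @ \oo --> (0 : R).
  pose b n := (2 * (sumn c)%:R) * (series (@harmonic R) n.+1 ^+ sumn c / n.+1%:R).
  have b_cvg : b @ \oo --> (0 : R).
    by rewrite -[X in _ --> X](mulr0 (2 * (sumn c)%:R)); apply: cvgMr; exact: harmonic_pow_cvg.
  apply/norm_cvg0P; apply: (@squeeze_cvgr _ _ _ _ (fun=> 0) b) => //; last exact: cvg_cst.
  near=> n; rewrite normr_ge0 /=.
  have := @discr_error R n.+1 isT c cn c0 sc; move=> /le_trans; apply.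
  have -> : b n = (sumn c)%:R * (\sum_(0 <= j < n.+1) j.+1%:R^-1) ^+ sumn c * 2 / n.+1%:R.
    by rewrite /b seriesEnat /=; ring.
  apply: ler_wpM2l; last by rewrite lef_pV2 ?posrE // ler_nat.
  rewrite mulr_ge0 // mulr_ge0 // exprn_ge0 //.
  by apply: sumr_ge0 => i _; rewrite invr_ge0.
have -> : [sequence mchain (xw R n.+1) (yw R n.+1) c (fun=> 1) n.+1]_n =
    fun n => discr R n.+1 c - e n.
  by apply/funext => n; rewrite /e /=; ring.
by rewrite -[l]subr0; apply: cvgB.
Unshelve. all: by end_near. Qed.

End Limits.

Theorem mainTheorem2 (R : realType) (s : nat) (c : seq nat) :
  (0 < s)%N -> size c = (2 * s)%N -> all (fun k => 0 < k)%N c ->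
  mzv R (lhs_index c) = Zlin R (Dfrak c).
Proof.
move=> s0 sc c0.
have cn : c != [::] by rewrite -size_eq0 sc; lia.
have ec : ~~ odd (size c) by rewrite sc oddM.
have [E /(_ cn) g] := Dfuel_spec R (leqnn (sumn c)) c0 ec.
have S_cvg : (fun n => discr R n c) @ \oo --> Zlin R (Dfrak c).
  have <- : (fun n => trunc_poly R n (Dfrak c)) = fun n => discr R n c.
    by apply/funext => n; rewrite /Dfrak E.
  exact: trunc_poly_cvg.
(* The left index may contain entries 1; convergence of its truncations comes from the comparison
   with [discr], whose limit is already known. *)
apply/cvg_lim => //.
have -> : (fun n => mzv_partial R (lhs_index c) n) =
    fun n => mchain (xw R n) (yw R n) c (fun=> 1) n.
  by apply/funext => n; rewrite mzv_partial_mchain.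
exact: mchain_cvg.
Qed.
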